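(* (1) $\dim_K(\mathrm{End}_{\mathbb{I}_1}(M))<\infty$ for all simple $\mathbb{I}_1$-modules $M$. (2) $\mathrm{End}_{\mathbb{I}_1}(K[x])\simeq K$. (3) $\mathrm{End}_{\mathbb{I}_1}(B_1/B_1\mathfrak{p})\simeq K[H]/\mathfrak{p}$ for all maximal ideals $\mathfrak{p}$ of $K[H]$.
   Context: $K$ is a field of characteristic zero; modules are left modules. $\mathbb{I}_1$ is the subalgebra of $\mathrm{End}_K(K[x])$ generated by (multiplication by) $x$, $\partial=\frac{d}{dx}$ and $\int: x^n\mapsto \frac{x^{n+1}}{n+1}$; $K[x]$ is the natural $\mathbb{I}_1$-module. Put $H:=\partial x$ and $e_{ij}:=\int^i\partial^j-\int^{i+1}\partial^{j+1}$ ($i,j\ge0$); $F:=\bigoplus_{i,j\ge0}Ke_{ij}$ is an ideal of $\mathbb{I}_1$. The factor algebra $\mathbb{I}_1/F$ is identified with the skew Laurent polynomial algebra $B_1:=K[H][\partial,\partial^{-1};\tau]$, $\tau(H)=H+1$, $\partial^{\pm1}\alpha=\tau^{\pm1}(\alpha)\partial^{\pm1}$ for $\alpha\in K[H]$, via $\partial\mapsto\partial$, $\int\mapsto\partial^{-1}$, $H\mapsto H$; thus $B_1$-modules are $\mathbb{I}_1$-modules. *)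

(* Defs.v *)
From HB Require Import structures.
From mathcomp Require Import all_boot all_order all_algebra.
From mathcomp Require Import finmap.
From mathcomp Require Import boolp.
From mathcomp.multinomials Require Import monalg.

Set Implicit Arguments.
Unset Strict Implicit.
Unset Printing Implicit Defensive.

Import Order.TTheory GRing.Theory Num.Theory.

Local Open Scope ring_scope.

(* End_A(M) for a module M over a K-algebra A, with composition as product and
   K acting through the central scalars a%:A of A. It may be the zero ring, so
   it only carries a pzRingType and an lmodType K structure. *)
Section Endo.
Variables (K : comNzRingType) (A : algType K) (M : lmodType A).

Definition endo : Type := {linear M -> M}.

HB.instance Definition _ := gen_eqMixin endo.
HB.instance Definition _ := gen_choiceMixin endo.

Implicit Types f g h : endo.

Lemma endoP f g : f =1 g -> f = g.
Proof.
move=> fg; have {fg}/= : (f : M -> M) = g by exact/funext.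
case: f g => [f [[mf] [lf]]] [g [[mg] [lg]]] /= fg.
rewrite -{}fg in mg lg *.
by congr (GRing.Linear.Pack (GRing.Linear.Class _ _)); congr (_ _);
  exact: Prop_irrelevance.
Qed.

Definition endo0 : endo := \0 : {linear M -> M}.
Definition endo_opp f : endo := \- f : {linear M -> M}.
Definition endo_add f g : endo := f \+ g : {linear M -> M}.
Definition endo1 : endo := idfun : {linear M -> M}.
Definition endo_mul f g : endo := f \o g : {linear M -> M}.

Lemma endo_addA : associative endo_add.
Proof. by move=> f g h; apply: endoP => m /=; rewrite addrA. Qed.
Lemma endo_addC : commutative endo_add.
Proof. by move=> f g; apply: endoP => m /=; rewrite addrC. Qed.
Lemma endo_add0 : left_id endo0 endo_add.
Proof. by move=> f; apply: endoP => m /=; rewrite add0r. Qed.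
Lemma endo_addN : left_inverse endo0 endo_opp endo_add.
Proof. by move=> f; apply: endoP => m /=; rewrite addNr. Qed.

HB.instance Definition _ :=
  GRing.isZmodule.Build endo endo_addA endo_addC endo_add0 endo_addN.

Lemma endo_mulA : associative endo_mul.
Proof. by move=> f g h; apply: endoP. Qed.
Lemma endo_mul1 : left_id endo1 endo_mul.
Proof. by move=> f; apply: endoP. Qed.
Lemma endo_mulr1 : right_id endo1 endo_mul.
Proof. by move=> f; apply: endoP. Qed.
Lemma endo_mulDl : left_distributive endo_mul endo_add.
Proof. by move=> f g h; apply: endoP. Qed.
Lemma endo_mulDr : right_distributive endo_mul endo_add.
Proof. by move=> f g h; apply: endoP => m /=; rewrite linearD. Qed.

HB.instance Definition _ := GRing.Zmodule_isPzRing.Build endo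
  endo_mulA endo_mul1 endo_mulr1 endo_mulDl endo_mulDr.

Definition endo_scale_fun (a : K) f (m : M) : M := a%:A *: f m.

Lemma endo_scale_linear a f : linear (endo_scale_fun a f).
Proof.
move=> b u v; rewrite /endo_scale_fun linearP scalerDr !scalerA.
by rewrite -scalerAl mul1r -scalerAr mulr1.
Qed.

HB.instance Definition _ a f :=
  GRing.isLinear.Build A M M *:%R (endo_scale_fun a f) (endo_scale_linear a f).

Definition endo_scale a f : endo := endo_scale_fun a f : {linear M -> M}.

Lemma endo_scaleA a b f : endo_scale a (endo_scale b f) = endo_scale (a * b) f.
Proof.
apply: endoP => m; rewrite /= /endo_scale_fun scalerA.
by rewrite -scalerAl mul1r scalerA.
Qed.
Lemma endo_scale1 : left_id 1 endo_scale.
Proof. by move=> f; apply: endoP => m; rewrite /= /endo_scale_fun !scale1r. Qed.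
Lemma endo_scaleDr : right_distributive endo_scale +%R.
Proof. by move=> a f g; apply: endoP => m; rewrite /= /endo_scale_fun scalerDr. Qed.
Lemma endo_scaleDl f : {morph endo_scale^~ f : a b / a + b}.
Proof.
by move=> a b; apply: endoP => m; rewrite /= /endo_scale_fun !scalerDl.
Qed.

HB.instance Definition _ := GRing.Zmodule_isLmodule.Build K endo
  endo_scaleA endo_scale1 endo_scaleDr endo_scaleDl.

Lemma endo_scaleAl (a : K) f g : a *: (f * g) = (a *: f) * g.
Proof. by apply: endoP. Qed.

Lemma endo_scaleAr (a : K) f g : a *: (f * g) = f * (a *: g).
Proof. by apply: endoP => m /=; rewrite /endo_scale_fun linearZ. Qed.

End Endo.

Section GeneratedSubalgebra.
Variables (K : comNzRingType) (A : algType K) (G : seq A).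

(* The smallest subalgebra of A containing G. *)
Definition gen_subalg : {pred A} := fun a =>
  `[< forall S : {pred A},
      GRing.subalg_closed S -> {subset G <= S} -> a \in S >].

Lemma mem_gen_subalg : {subset G <= gen_subalg}.
Proof. by move=> a aG; apply/asboolP => S _; apply. Qed.

Lemma gen_subalg_closed : GRing.subalg_closed gen_subalg.
Proof.
split=> [|c u v /asboolP uG /asboolP vG|u v /asboolP uG /asboolP vG];
  apply/asboolP => S Salg GS; case: (Salg) => // S1 SD SM.
- exact: SD (uG S Salg GS) (vG S Salg GS).
- exact: SM (uG S Salg GS) (vG S Salg GS).
Qed.

HB.instance Definition _ :=
  GRing.isSubalgClosed.Build K A gen_subalg
    (GRing.subalg_closed_semi gen_subalg_closed).

End GeneratedSubalgebra.

Section I1.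
Variable K : fieldType.

(* End_K(K[x]); K^o is K seen as an algebra over itself. *)
Definition EndKx := endo ({poly K} : lmodType K^o).

HB.instance Definition _ := GRing.PzRing.on EndKx.
HB.instance Definition _ := GRing.Lmodule.on EndKx.

Lemma EndKx_nonzero : 1 != 0 :> EndKx.
Proof.
apply/eqP => /(congr1 (fun f : EndKx => f 1)) /= /eqP.
by rewrite oner_eq0.
Qed.

HB.instance Definition _ := GRing.PzSemiRing_isNonZero.Build EndKx EndKx_nonzero.
HB.instance Definition _ := GRing.Lmodule_isLalgebra.Build K EndKx
  (@endo_scaleAl _ _ _).
HB.instance Definition _ := GRing.Lalgebra_isAlgebra.Build K EndKx
  (@endo_scaleAr _ _ _).

Definition mulX (p : {poly K}) : {poly K} := 'X * p.

Lemma mulX_linear : linear (mulX : {poly K} -> ({poly K} : lmodType K^o)).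
Proof. by move=> a p q; rewrite /mulX mulrDr -scalerAr. Qed.
HB.instance Definition _ :=
  GRing.isLinear.Build K^o {poly K} {poly K} *:%R mulX mulX_linear.


Definition derivx (p : {poly K}) : {poly K} := p^`().
Lemma derivx_linear : linear (derivx : {poly K} -> ({poly K} : lmodType K^o)).
Proof. by move=> a p q; rewrite /derivx linearP. Qed.
HB.instance Definition _ :=
  GRing.isLinear.Build K^o {poly K} {poly K} *:%R derivx derivx_linear.


(* x^n |-> x^(n+1) / (n+1); in characteristic zero no division is by 0. *)
Definition integx (p : {poly K}) : {poly K} :=
  \sum_(i < size p) (p`_i / i.+1%:R) *: 'X^(i.+1).

Lemma coef_integx p j : (integx p)`_j = if j is i.+1 then p`_i / i.+1%:R else 0.
Proof.
rewrite /integx coef_sum; under eq_bigr do rewrite coefZ coefXn.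
case: j => [|j].
  by rewrite big1 // => i _; rewrite mulr0.
have [jp|pj] := ltnP j (size p); last first.
  rewrite nth_default // mul0r big1 // => i _.
  by rewrite eqSS gtn_eqF ?mulr0 // (leq_trans _ pj).
rewrite (bigD1 (Ordinal jp)) //= eqxx mulr1 big1 ?addr0 // => i ij.
by rewrite eqSS eq_sym (negbTE (ij : (i : nat) != j)) mulr0.
Qed.

Lemma integx_linear : linear (integx : {poly K} -> ({poly K} : lmodType K^o)).
Proof.
move=> a p q; apply/polyP => -[|j]; rewrite coefD coefZ !coef_integx.
  by rewrite mulr0 addr0.
by rewrite coefD coefZ mulrDl mulrA.
Qed.
HB.instance Definition _ :=
  GRing.isLinear.Build K^o {poly K} {poly K} *:%R integx integx_linear.


Definition endx : EndKx := mulX : {linear _ -> _}.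
Definition endd : EndKx := derivx : {linear _ -> _}.
Definition endi : EndKx := integx : {linear _ -> _}.

Definition I1_pred : {pred EndKx} := gen_subalg [:: endx; endd; endi].
HB.instance Definition _ := GRing.SubalgClosed.on I1_pred.

Record I1 := MkI1 { I1val :> EndKx; I1valP : I1val \in I1_pred }.
HB.instance Definition _ := [isSub for I1val].
HB.instance Definition _ := [Choice of I1 by <:].
HB.instance Definition _ := [SubChoice_isSubAlgebra of I1 by <:].

End I1.

Section B1.
Variable K : fieldType.

(* The i-th power (i an integer) of the automorphism H |-> H + 1 of K[H], where
   'X stands for H. *)
Definition tau (i : int) : {poly K} -> {poly K} :=
  comp_poly ('X + (i%:~R)%:P).

HB.instance Definition _ i := GRing.RMorphism.on (tau i).

Lemma tau0 a : tau 0 a = a.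
Proof. by rewrite /tau addr0 comp_polyXr. Qed.

Lemma tauD i j a : tau (i + j) a = tau i (tau j a).
Proof.
rewrite /tau -comp_polyA comp_polyD comp_polyX comp_polyC; congr (_ \Po _).
by rewrite -addrA -polyCD -intrD.
Qed.

Lemma tau_horner i a x : (tau i a).[x] = a.[x + i%:~R].
Proof. by rewrite /tau horner_comp !hornerE. Qed.

(* K[H][d, d^-1; tau]: finitely supported families of elements of K[H] indexed
   by int, << p *g i >> standing for p d^i with coefficients on the left. The
   product is determined by p d^i q d^j = p tau^i(q) d^(i+j). The ambient
   {malg _[_]} only contributes its additive structure. *)
Definition B1 := {malg {poly K}[int]}.

HB.instance Definition _ := GRing.Zmodule.on B1.

Implicit Types (b c g : B1) (d : {fset int}) (i j : int).

Definition B1_one : B1 := << 1 *g 0 >>.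

Definition B1_mul b c : B1 :=
  \sum_(i <- msupp b) \sum_(j <- msupp c) << b@_i * tau i c@_j *g i + j >>.


Lemma B1_mulEw d1 d2 b c : (msupp b `<=` d1)%fset -> (msupp c `<=` d2)%fset ->
  B1_mul b c = \sum_(i <- d1) \sum_(j <- d2) << b@_i * tau i c@_j *g i + j >>.
Proof.
move=> le1 le2; rewrite /B1_mul (big_fset_incl _ le1) /=.
  apply/eq_bigr=> i _; apply/big_fset_incl => // j _ /mcoeff_outdom ->.
  by rewrite rmorph0 mulr0 monalgU0.
move=> i _ /mcoeff_outdom bi.
by rewrite big1 // => j _; rewrite bi mul0r monalgU0.
Qed.

Lemma B1_mulUU a a' i j :
  B1_mul << a *g i >> << a' *g j >> = << a * tau i a' *g i + j >>.
Proof. by rewrite (B1_mulEw msuppU_le msuppU_le) !big_seq_fset1 !mcoeffUU. Qed.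

Lemma B1_mulDl : left_distributive B1_mul +%R.
Proof.
move=> b b' c.
rewrite (B1_mulEw (msuppD_le b b') (fsubset_refl _)).
rewrite (B1_mulEw (fsubsetUl (msupp b) (msupp b')) (fsubset_refl (msupp c))).
rewrite (B1_mulEw (fsubsetUr (msupp b) (msupp b')) (fsubset_refl (msupp c))).
rewrite -big_split; apply/eq_bigr=> i _.
rewrite -big_split; apply/eq_bigr=> j _ /=.
by rewrite mcoeffD mulrDl monalgUD.
Qed.

Lemma B1_mulDr : right_distributive B1_mul +%R.
Proof.
move=> c b b'.
rewrite (B1_mulEw (fsubset_refl _) (msuppD_le b b')).
rewrite (B1_mulEw (fsubset_refl (msupp c)) (fsubsetUl (msupp b) (msupp b'))).
rewrite (B1_mulEw (fsubset_refl (msupp c)) (fsubsetUr (msupp b) (msupp b'))).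
rewrite -big_split; apply/eq_bigr=> i _.
rewrite -big_split; apply/eq_bigr=> j _ /=.
by rewrite mcoeffD rmorphD mulrDr monalgUD.
Qed.

Lemma B1_mul0 c : B1_mul 0 c = 0.
Proof. by rewrite /B1_mul msupp0 big_seq_fset0. Qed.

Lemma B1_mulr0 c : B1_mul c 0 = 0.
Proof. by rewrite /B1_mul msupp0 big1 // => i _; rewrite big_seq_fset0. Qed.

Lemma B1_ind (P : B1 -> Prop) : P 0 -> (forall b c, P b -> P c -> P (b + c)) ->
  (forall a i, P << a *g i >>) -> forall b, P b.
Proof. by move=> P0 PD PU b; rewrite [b]monalgE; apply: big_ind. Qed.

Lemma B1_mulA : associative B1_mul.
Proof.
move=> b c g; elim/B1_ind: b => [|b b' IH IH'|a i].
- by rewrite !B1_mul0.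
- by rewrite !B1_mulDl IH IH'.
elim/B1_ind: c => [|b b' IH IH'|a' j].
- by rewrite B1_mulr0 !B1_mul0 B1_mulr0.
- by rewrite B1_mulDr !B1_mulDl B1_mulDr IH IH'.
elim/B1_ind: g => [|b b' IH IH'|a'' k].
- by rewrite !B1_mulr0.
- by rewrite !B1_mulDr IH IH'.
by rewrite !B1_mulUU rmorphM tauD mulrA addrA.
Qed.

Lemma B1_mul1 : left_id B1_one B1_mul.
Proof.
elim/B1_ind => [|b b' IH IH'|a i].
- by rewrite B1_mulr0.
- by rewrite B1_mulDr IH IH'.
by rewrite B1_mulUU tau0 mul1r add0r.
Qed.

Lemma B1_mulr1 : right_id B1_one B1_mul.
Proof.
elim/B1_ind => [|b b' IH IH'|a i].
- by rewrite B1_mul0.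
- by rewrite B1_mulDl IH IH'.
by rewrite B1_mulUU rmorph1 mulr1 addr0.
Qed.

Lemma B1_one_neq0 : B1_one != 0.
Proof. by rewrite monalgU_eq0 oner_eq0. Qed.

HB.instance Definition _ := GRing.Zmodule_isNzRing.Build B1
  B1_mulA B1_mul1 B1_mulr1 B1_mulDl B1_mulDr B1_one_neq0.

Lemma B1_mulU p q i j :
  (<< p *g i >> : B1) * (<< q *g j >> : B1) = << p * tau i q *g i + j >>.
Proof. exact: B1_mulUU. Qed.

Definition B1_poly (p : {poly K}) : B1 := << p *g 0 >>.
Definition B1_d : B1 := << 1 *g 1 >>.
Definition B1_dV : B1 := << 1 *g (-1) >>.

Definition B1_scale (a : K) b : B1 := B1_poly a%:P * b.

Lemma B1_scaleU (a : K) p i : B1_scale a << p *g i >> = << a *: p *g i >>.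
Proof. by rewrite /B1_scale B1_mulU tau0 add0r mul_polyC. Qed.

Lemma B1_scaleA a a' b : B1_scale a (B1_scale a' b) = B1_scale (a * a') b.
Proof. by rewrite /B1_scale mulrA B1_mulU tau0 polyCM addr0. Qed.

Lemma B1_scale1 : left_id 1 B1_scale.
Proof. by move=> b; rewrite /B1_scale (_ : B1_poly _ = 1) ?mul1r. Qed.

Lemma B1_scaleDr : right_distributive B1_scale +%R.
Proof. by move=> a b c; rewrite /B1_scale mulrDr. Qed.

Lemma B1_scaleDl b : {morph B1_scale^~ b : a a' / a + a'}.
Proof.
by move=> a a'; rewrite /B1_scale /B1_poly polyCD monalgUD mulrDl.
Qed.

HB.instance Definition _ := GRing.Zmodule_isLmodule.Build K B1
  B1_scaleA B1_scale1 B1_scaleDr B1_scaleDl.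

Lemma B1_scaleAl (a : K) b c : a *: (b * c) = (a *: b) * c.
Proof. exact: mulrA. Qed.

HB.instance Definition _ := GRing.Lmodule_isLalgebra.Build K B1 B1_scaleAl.

Lemma B1_scaleAr (a : K) b c : a *: (b * c) = b * (a *: c).
Proof.
rewrite /GRing.scale /= /B1_scale !mulrA; congr (_ * _).
elim/B1_ind: b => [|b b' IH IH'|p i].
- by rewrite mulr0 mul0r.
- by rewrite mulrDr mulrDl IH IH'.
by rewrite !B1_mulU tau0 /tau comp_polyC mulrC addrC.
Qed.

HB.instance Definition _ := GRing.Lalgebra_isAlgebra.Build K B1 B1_scaleAr.

End B1.

Section Germ.
Variable K : fieldType.
Implicit Types (f g : EndKx K) (b c : B1 K) (i j m : int).

(* The divided powers x^m / m!, with value 0 for m < 0. On them d, int and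
   H = d x act by d x^[m] = x^[m-1], int x^[m] = x^[m+1] and
   H x^[m] = (m+1) x^[m], so p(H) d^i sends x^[m] to p(m-i+1) x^[m-i]; an
   element of I_1 acts on x^[m], for all large m, as a unique element of B_1,
   which is its image in I_1/F = B_1. *)
Definition divpow (m : int) : {poly K} :=
  if m is Posz n then n`!%:R^-1 *: 'X^n else 0.

Definition B1_act (m : int) b : {poly K} :=
  \sum_(i <- msupp b) (b@_i).[(m - i + 1)%:~R] *: divpow (m - i).

Definition germ f b : Prop :=
  exists N : nat, forall m : int, (N%:Z <= m)%R -> f (divpow m) = B1_act m b.

Lemma B1_actEw m (d : {fset int}) b : (msupp b `<=` d)%fset ->
  B1_act m b = \sum_(i <- d) (b@_i).[(m - i + 1)%:~R] *: divpow (m - i).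
Proof.
move=> le; rewrite /B1_act (big_fset_incl _ le) //= => i _ /mcoeff_outdom ->.
by rewrite horner0 scale0r.
Qed.

Lemma B1_actU m p i :
  B1_act m << p *g i >> = p.[(m - i + 1)%:~R] *: divpow (m - i).
Proof. by rewrite (B1_actEw _ msuppU_le) big_seq_fset1 mcoeffUU. Qed.

Lemma B1_act0 m : B1_act m 0 = 0.
Proof. by rewrite /B1_act msupp0 big_seq_fset0. Qed.

Lemma B1_actD m b c : B1_act m (b + c) = B1_act m b + B1_act m c.
Proof.
rewrite (B1_actEw _ (msuppD_le b c)).
rewrite (B1_actEw _ (fsubsetUl (msupp b) (msupp c))).
rewrite (B1_actEw _ (fsubsetUr (msupp b) (msupp c))).
rewrite -big_split; apply: eq_bigr => i _ /=.
by rewrite mcoeffD hornerD scalerDl.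
Qed.

Lemma B1_act_sum m (I : Type) (r : seq I) (F : I -> B1 K) :
  B1_act m (\sum_(i <- r) F i) = \sum_(i <- r) B1_act m (F i).
Proof. exact: (big_morph _ (@B1_actD m) (B1_act0 m)). Qed.

Lemma B1_actZ m (a : K) b : B1_act m (a *: b) = a *: B1_act m b.
Proof.
elim/B1_ind: b => [|b c IHb IHc|p i].
- by rewrite scaler0 B1_act0 scaler0.
- by rewrite scalerDr !B1_actD IHb IHc scalerDr.
by rewrite [a *: _]B1_scaleU !B1_actU hornerZ scalerA.
Qed.

Lemma germ_mul f g b c : germ f b -> germ g c -> germ (f * g) (b * c).
Proof.
move=> [Nb fb] [Nc gc]; exists (Nc + (Nb + \sum_(j <- msupp c) `|j|%N))%N.
move=> m lem.
have leNc : (Nc%:Z <= m)%R by apply: le_trans lem; rewrite lez_nat leq_addr.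
rewrite [LHS]/= gc // (_ : b * c = B1_mul b c) // B1_act_sum [B1_act m c]/B1_act linear_sum.
under [RHS]eq_bigr do rewrite B1_act_sum.
rewrite [RHS]exchange_big big_seq [RHS]big_seq; apply: eq_bigr => j jc /=.
have lej : (Nb%:Z <= m - j)%R.
  rewrite lerBrDr; apply: le_trans lem.
  rewrite !PoszD addrCA lerD2l (le_trans (ler_norm j)) //.
  rewrite (@le_trans _ _ (\sum_(k <- msupp c) `|k|%N)%N%:Z) ?lerDr //.
  by rewrite -abszE lez_nat (big_rem j) //= leq_addr.
rewrite linearZ /= fb // [B1_act (m - j) b]/B1_act scaler_sumr; apply: eq_bigr => i _.
rewrite B1_actU hornerM tau_horner scalerA -[in RHS]intrD.
have -> : m - (i + j) = m - j - i by rewrite opprD addrA addrAC.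
by rewrite mulrC [m - j - i + 1 + i]addrAC subrK.
Qed.

Lemma germ_lin (a : K) f g b c :
  germ f b -> germ g c -> germ (a *: f + g) (a *: b + c).
Proof.
move=> [Nb fb] [Nc gc]; exists (maxn Nb Nc) => m lem.
have leb : (Nb%:Z <= m)%R by apply: le_trans lem; rewrite lez_nat leq_maxl.
have lec : (Nc%:Z <= m)%R by apply: le_trans lem; rewrite lez_nat leq_maxr.
rewrite /= /endo_scale_fun fb // gc // B1_actD B1_actZ; congr (_ + _).
by rewrite /GRing.scale /= mulr1.
Qed.

Lemma germ1 : germ 1 1.
Proof.
exists 0%N => m _; rewrite [1 in RHS](_ : _ = << 1 *g 0 >>) // B1_actU.
by rewrite subr0 hornerE scale1r.
Qed.

Lemma germ_i : germ (endi K) (B1_dV K).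
Proof.
exists 0%N => -[n|n] // _; rewrite B1_actU hornerE scale1r opprK -PoszD addn1 /=.
apply/polyP => -[|j]; rewrite /= coef_integx coefZ coefXn ?mulr0 //.
rewrite coefZ coefXn eqSS; case: eqVneq => [->|_]; last by rewrite !mulr0 mul0r.
by rewrite !mulr1 factS natrM invfM mulrC.
Qed.

Variable charK : [pchar K] =i pred0.

Lemma natrS_neq0 n : n.+1%:R != 0 :> K.
Proof. by rewrite ((pcharf0P K).1 charK). Qed.

Lemma subSz1 n : n.+1%:Z - 1 = n.
Proof. by rewrite -addn1 PoszD addrK. Qed.

Lemma germ_d : germ (endd K) (B1_d K).
Proof.
exists 1%N => -[[|n]|n] // _; rewrite B1_actU hornerE scale1r subSz1 /=.
rewrite /derivx derivZ derivXn /= -scaler_nat scalerA; congr (_ *: _).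
by rewrite factS natrM invfM mulrAC mulVf ?natrS_neq0 ?mul1r.
Qed.

Lemma germ_x : germ (endx K) (<< 'X - 1 *g (-1) >> : B1 K).
Proof.
exists 0%N => -[n|n] // _; rewrite B1_actU opprK -PoszD addn1 !hornerE /=.
rewrite addn1 -[n.+2%:~R]natr1 addrK /mulX -scalerAr -exprS scalerA; congr (_ *: _).
by rewrite factS natrM invfM mulrA mulfV ?natrS_neq0 ?mul1r.
Qed.

Lemma coef_divpow m n : (divpow m)`_n = if m == n then n`!%:R^-1 else 0.
Proof.
case: m => [k|k] /=; last by rewrite coef0.
rewrite coefZ coefXn eqz_nat eq_sym; case: eqVneq => [->|_].
  by rewrite mulr1.
by rewrite mulr0.
Qed.

Lemma coef_B1_act b i n :
  (B1_act (i + n%:Z) b)`_n = (b@_i).[n.+1%:R] / n`!%:R.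
Proof.
rewrite (@B1_actEw _ (i |` msupp b)%fset) ?fsubsetU1 // coef_sum.
rewrite (big_fsetD1 i) ?fset1U1 //= big1_fset => [|j]; last first.
  rewrite !inE => /andP[ji _] _; rewrite coefZ coef_divpow.
  have /negbTE-> : i + n%:Z - j != n.
    by rewrite -subr_eq0 addrAC addrK subr_eq0 eq_sym.
  by rewrite mulr0.
rewrite addr0 coefZ coef_divpow [i + _]addrC addrK eqxx.
by rewrite (_ : n%:Z + 1 = n.+1) // -addn1 PoszD.
Qed.

Lemma natr_inj : injective (fun n => n%:R : K).
Proof.
move=> k l; wlog lekl : k l / (k <= l)%N => [wlg|/esym/eqP].
  by case/orP: (leq_total k l) => /wlg // wl /esym/wl.
by rewrite -subr_eq0 -natrB // ((pcharf0P K).1 charK) subn_eq0 => lelk;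
  apply/eqP; rewrite eqn_leq lekl.
Qed.

Lemma poly_eq0_nat (p : {poly K}) (N : nat) :
  (forall n, (N <= n)%N -> p.[n.+1%:R] = 0) -> p = 0.
Proof.
move=> p0; apply: (@roots_geq_poly_eq0 _ _
  [seq (N + k).+1%:R | k <- iota 0 (size p)]).
- by apply/allP => _ /mapP[k _ ->]; apply/rootP/p0/leq_addr.
- by rewrite map_inj_uniq ?iota_uniq // => k l /natr_inj [] /addnI.
- by rewrite size_map size_iota.
Qed.

Lemma germ_uniq f b c : germ f b -> germ f c -> b = c.
Proof.
move=> [Nb fb] [Nc fc]; apply/malgP => i; apply/eqP; rewrite -subr_eq0.
apply/eqP/(@poly_eq0_nat _ (Nb + Nc + `|i|)) => n len.
have lem : ((Nb + Nc)%:Z <= i + n)%R.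
  rewrite -lerBlDl (@le_trans _ _ ((Nb + Nc + `|i|)%N : int)) ?lez_nat //.
  by rewrite [X in _ <= X]PoszD lerD2l abszE -normrN ler_norm.
have := coef_B1_act b i n; rewrite -fb; last first.
  by apply: le_trans lem; rewrite lez_nat leq_addr.
rewrite fc ?coef_B1_act; last by apply: le_trans lem; rewrite lez_nat leq_addl.
have nfact : n`!%:R != 0 :> K by rewrite ((pcharf0P K).1 charK) -lt0n fact_gt0.
by move=> /(mulIf (invr_neq0 nfact)) bc; rewrite hornerD hornerN bc subrr.
Qed.

End Germ.

Section I1Generators.
Variable K : fieldType.

Lemma I1_mem (f : EndKx K) :
  f \in [:: endx K; endd K; endi K] -> f \in @I1_pred K.
Proof. exact: mem_gen_subalg. Qed.

Lemma I1x_subproof : endx K \in @I1_pred K.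
Proof. by apply: I1_mem; rewrite !inE eqxx. Qed.
Lemma I1d_subproof : endd K \in @I1_pred K.
Proof. by apply: I1_mem; rewrite !inE eqxx orbT. Qed.
Lemma I1i_subproof : endi K \in @I1_pred K.
Proof. by apply: I1_mem; rewrite !inE eqxx !orbT. Qed.

Definition I1x : I1 K := MkI1 I1x_subproof.
Definition I1d : I1 K := MkI1 I1d_subproof.
Definition I1i : I1 K := MkI1 I1i_subproof.
Definition I1H : I1 K := I1d * I1x.

Definition I1e (i j : nat) : I1 K :=
  I1i ^+ i * I1d ^+ j - I1i ^+ i.+1 * I1d ^+ j.+1.

(* F, the K-span of the e_ij. *)
Definition I1F (f : I1 K) : Prop :=
  exists n (c : 'I_n -> 'I_n -> K),
    f = \sum_(i < n) \sum_(j < n) c i j *: I1e i j.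

End I1Generators.

Section Projection.
Variables (K : fieldType) (charK : [pchar K] =i pred0).
Implicit Types f g : I1 K.

Lemma I1_germ f : exists b, germ (I1val f) b.
Proof.
have /asboolP/(_ (fun h => `[< exists b, germ h b >])) h := I1valP f.
apply/asboolP; apply: h.
  split=> [|a u v /asboolP[b ub] /asboolP[c vc]|u v /asboolP[b ub] /asboolP[c vc]];
    apply/asboolP.
  - by exists 1; apply: germ1.
  - by exists (a *: b + c); apply: germ_lin.
  - by exists (b * c); apply: germ_mul.
move=> u; rewrite !inE => /or3P[] /eqP->; apply/asboolP.
- by eexists; apply: germ_x.
- by eexists; apply: germ_d.
- by eexists; apply: germ_i.
Qed.

(* The projection I_1 -> I_1/F = B_1. It is the K-algebra morphism with
   d |-> d, int |-> d^-1, H |-> H (I1_to_B1_d, I1_to_B1_i, I1_to_B1_H), it is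
   onto (I1_to_B1_surj) and its kernel is F (I1_to_B1_ker). *)
Definition I1_to_B1 f : B1 K := projT1 (cid (I1_germ f)).

Lemma I1_to_B1P f : germ (I1val f) (I1_to_B1 f).
Proof. exact: projT2 (cid (I1_germ f)). Qed.

Lemma I1_to_B1E f b : germ (I1val f) b -> I1_to_B1 f = b.
Proof. by move=> fb; apply: (germ_uniq charK (I1_to_B1P f) fb). Qed.

Lemma I1_to_B1_linear : linear I1_to_B1.
Proof. by move=> a f g; apply: I1_to_B1E; apply: germ_lin; apply: I1_to_B1P. Qed.

Lemma I1_to_B1_monoid : monoid_morphism I1_to_B1.
Proof.
split=> [|f g]; apply: I1_to_B1E; first exact: germ1.
by apply: germ_mul; apply: I1_to_B1P.
Qed.

HB.instance Definition _ :=
  GRing.isLinear.Build K (I1 K) (B1 K) *:%R I1_to_B1 I1_to_B1_linear.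
HB.instance Definition _ :=
  GRing.isMonoidMorphism.Build (I1 K) (B1 K) I1_to_B1 I1_to_B1_monoid.

Lemma I1_to_B1_d : I1_to_B1 (I1d K) = B1_d K.
Proof. exact/I1_to_B1E/germ_d. Qed.

Lemma I1_to_B1_i : I1_to_B1 (I1i K) = B1_dV K.
Proof. exact/I1_to_B1E/germ_i. Qed.

Lemma I1_to_B1_H : I1_to_B1 (I1H K) = B1_poly 'X.
Proof.
rewrite rmorphM /= I1_to_B1_d (@I1_to_B1E (I1x K) _ (germ_x charK)) B1_mulU mul1r subrr.
by congr << _ *g _ >>; rewrite rmorphB rmorph1 /= /tau comp_polyX addrK.
Qed.

Lemma B1_mulVd : B1_dV K * B1_d K = 1.
Proof. by rewrite B1_mulU rmorph1 mulr1. Qed.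

Lemma B1_muldV : B1_d K * B1_dV K = 1.
Proof. by rewrite B1_mulU rmorph1 mulr1. Qed.

Lemma B1_poly_linear : linear (@B1_poly K).
Proof. by move=> a p q; rewrite /B1_poly monalgUD [a *: _ in RHS]B1_scaleU. Qed.

Lemma B1_poly_monoid : monoid_morphism (@B1_poly K).
Proof. by split=> // p q; rewrite B1_mulU tau0. Qed.

HB.instance Definition _ :=
  GRing.isLinear.Build K {poly K} (B1 K) *:%R (@B1_poly K) B1_poly_linear.
HB.instance Definition _ :=
  GRing.isMonoidMorphism.Build {poly K} (B1 K) (@B1_poly K) B1_poly_monoid.

Lemma I1_to_B1_surj b : exists f, I1_to_B1 f = b.
Proof.
pose D (i : int) : I1 K := if i is Posz n then I1d K ^+ n else I1i K ^+ `|i|.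
have DE i : I1_to_B1 (D i) = << 1 *g i >>.
  have dE n : B1_d K ^+ n = << 1 *g n%:Z >>.
    elim: n => [|n IHn]; first by [].
    by rewrite exprS IHn B1_mulU rmorph1 mulr1 -PoszD.
  have iE n : B1_dV K ^+ n = << 1 *g - n%:Z >>.
    elim: n => [|n IHn]; first by [].
    by rewrite exprS IHn B1_mulU rmorph1 mulr1 -opprD -PoszD.
  by case: i => n; rewrite /D rmorphXn /= ?I1_to_B1_d ?I1_to_B1_i ?dE ?iE ?NegzE.
elim/B1_ind: b => [|b c [f <-] [g <-]|p i].
- by exists 0; rewrite rmorph0.
- by exists (f + g); rewrite rmorphD.
have [f fp] : exists f, I1_to_B1 f = B1_poly p.
  elim/poly_ind: p => [|p c [f fp]]; first by exists 0; rewrite !rmorph0.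
  exists (f * I1H K + c%:A); rewrite rmorphD rmorphM /= fp I1_to_B1_H.
  rewrite [RHS]rmorphD rmorphM /=; congr (_ + _).
  by rewrite linearZ rmorph1; exact: mulr1.
by exists (f * D i); rewrite rmorphM /= fp DE B1_mulU tau0 mulr1 add0r.
Qed.

Lemma endo_divpowP (f g : EndKx K) :
  (forall n : nat, f (divpow K n) = g (divpow K n)) -> f = g.
Proof.
move=> fg; apply: endoP => p; rewrite -[p]coefK poly_def !linear_sum.
apply: eq_bigr => k _.
have -> : 'X^k = k`!%:R *: divpow K k.
  rewrite scalerA mulfV ?scale1r //.
  by rewrite ((pcharf0P K).1 charK) -lt0n fact_gt0.
by move: (divpow K k) (fg k) => e fgk; rewrite scalerA !linearZ fgk.
Qed.

Lemma I1act_mul f g x : I1val (f * g) x = I1val f (I1val g x).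
Proof. by []. Qed.

Lemma I1act_sub f g x : I1val (f - g) x = I1val f x - I1val g x.
Proof. by []. Qed.

Lemma I1act_sum (I : Type) (r : seq I) (F : I -> I1 K) x :
  I1val (\sum_(i <- r) F i) x = \sum_(i <- r) I1val (F i) x.
Proof. exact: (big_morph (fun f => I1val f x)). Qed.

Lemma I1act_scale (a : K) f x : I1val (a *: f) x = a *: I1val f x.
Proof. by rewrite /= /endo_scale_fun; congr (_ *: _); apply: mulr1. Qed.

Lemma I1d_divpow m : I1val (I1d K) (divpow K m) = divpow K (m - 1).
Proof.
case: m => [[|n]|n]; first by rewrite /= /derivx derivZ derivXn scaler0.
  rewrite subSz1 /= /derivx derivZ derivXn /= -scaler_nat scalerA; congr (_ *: _).
  by rewrite factS natrM invfM mulrAC mulVf ?natrS_neq0 ?mul1r.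
by rewrite [LHS]linear0.
Qed.

Lemma I1dX_divpow j m : I1val (I1d K ^+ j) (divpow K m) = divpow K (m - j%:Z).
Proof.
elim: j => [|j IHj]; first by rewrite subr0.
by rewrite exprS I1act_mul IHj I1d_divpow -addrA -opprD -PoszD addn1.
Qed.

Lemma I1iX_divpow i (n : nat) :
  I1val (I1i K ^+ i) (divpow K n) = divpow K (i + n)%N.
Proof.
elim: i => [|i IHi]; first by [].
rewrite exprS I1act_mul IHi; apply/polyP => -[|l]; rewrite /= coef_integx.
  by rewrite coefZ coefXn mulr0.
rewrite !coefZ !coefXn eqSS; case: eqVneq => [->|_]; last by rewrite !mulr0 mul0r.
by rewrite !mulr1 addSn factS natrM invfM mulrC.
Qed.

Lemma I1e_divpow i j (k : nat) :
  I1val (I1e K i j) (divpow K k) = if k == j then divpow K i else 0.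
Proof.
rewrite I1act_sub !I1act_mul !I1dX_divpow.
have divNeg (h : EndKx K) l m : (l < m)%N -> h (divpow K (l%:Z - m%:Z)) = 0.
  move=> lm; rewrite -[m](subnK lm) addnS -addSn PoszD opprD addrCA subrr addr0.
  by rewrite -NegzE linear0.
case: (ltngtP k j) => [kj|jk|->].
- by rewrite !divNeg ?subrr // ltnS ltnW.
- by rewrite (subzn (ltnW jk)) (subzn jk) !I1iX_divpow addSnnS subnSK // subrr.
- by rewrite (divNeg _ j j.+1) // subrr I1iX_divpow addn0 subr0.
Qed.

Lemma I1_to_B1_ker f : I1_to_B1 f = 0 <-> I1F f.
Proof.
split=> [f0|[n [c ->]]]; last first.
  rewrite linear_sum big1 // => i _; rewrite linear_sum big1 // => j _.
  rewrite linearZ /= /I1e rmorphB !rmorphM !rmorphXn /= I1_to_B1_d I1_to_B1_i.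
  rewrite exprSr exprS -mulrA [B1_dV K * _]mulrA B1_mulVd mul1r subrr.
  exact: scaler0.
have [N fN] := I1_to_B1P f; rewrite f0 in fN.
pose n := maxn N (\max_(j < N) size (I1val f (divpow K j))).
pose c (i j : 'I_n) : K := (I1val f (divpow K j))`_i * i`!%:R.
exists n, c.
apply: val_inj; apply: endo_divpowP => k.
rewrite I1act_sum; under eq_bigr => i _ do rewrite I1act_sum.
rewrite exchange_big /=.
have inner (j : 'I_n) :
    \sum_(i < n) I1val (c i j *: I1e K i j) (divpow K k) = if k == j then I1val f (divpow K k) else 0.
  under eq_bigr do rewrite I1act_scale I1e_divpow.
  case: eqP => [->|_]; last by rewrite big1 // => i _; rewrite scaler0.
  set q := I1val f _; have szq : (size q <= n)%N.
    have [jN|Nj] := ltnP j N; last first.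
      by rewrite /q fN ?lez_nat // B1_act0 size_poly0.
    rewrite (leq_trans _ (leq_maxr _ _)) //.
    exact: (leq_bigmax (Ordinal jN)).
  transitivity (\poly_(i < n) q`_i).
    rewrite poly_def; apply: eq_bigr => i _.
    by rewrite scalerA mulfK // ((pcharf0P K).1 charK) -lt0n fact_gt0.
  apply/polyP => i; rewrite coef_poly; case: ltnP => // ni.
  by rewrite nth_default // (leq_trans szq).
under eq_bigr => j _ do rewrite inner.
have [kn|nk] := ltnP k n; last first.
  rewrite fN.
    by rewrite B1_act0 big1 // => j _; case: eqP.
  by rewrite lez_nat (leq_trans _ nk) ?leq_maxl.
rewrite (bigD1 (Ordinal kn)) //= eqxx big1 ?addr0 // => j.
by rewrite -val_eqE /= eq_sym => /negbTE->.
Qed.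

End Projection.

Definition simple_module (R : pzRingType) (M : lmodType R) : Prop :=
  (exists m : M, m != 0) /\
  forall N : {pred M}, GRing.submod_closed N ->
    (forall m, m \in N -> m = 0) \/ (forall m, m \in N).

Definition restrict_scalars (R S : pzRingType) (f : {rmorphism R -> S})
  (M : lmodType S) : Type := M.

Section RestrictScalars.
Variables (R S : pzRingType) (f : {rmorphism R -> S}) (M : lmodType S).
Local Notation fM := (restrict_scalars f M).

HB.instance Definition _ := GRing.Zmodule.on fM.

Definition restrict_scale (a : R) (m : fM) : fM := f a *: (m : M).

Lemma restrict_scaleA a b m :
  restrict_scale a (restrict_scale b m) = restrict_scale (a * b) m.
Proof. by rewrite /restrict_scale scalerA rmorphM. Qed.
Lemma restrict_scale1 : left_id 1 restrict_scale.
Proof. by move=> m; rewrite /restrict_scale rmorph1 scale1r. Qed.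
Lemma restrict_scaleDr : right_distributive restrict_scale +%R.
Proof. by move=> a m n; rewrite /restrict_scale [LHS]scalerDr. Qed.
Lemma restrict_scaleDl m : {morph restrict_scale^~ m : a b / a + b}.
Proof. by move=> a b; rewrite /restrict_scale rmorphD [LHS]scalerDl. Qed.

HB.instance Definition _ := GRing.Zmodule_isLmodule.Build R fM
  restrict_scaleA restrict_scale1 restrict_scaleDr restrict_scaleDl.

End RestrictScalars.

Section QuotientModule.
Variables (R : pzRingType) (M : lmodType R) (N : submodClosed M).

Definition submod_pred : {pred M} := N.

Lemma submod_pred_closed : zmod_closed submod_pred.
Proof.
by split=> [|u v uN vN]; rewrite /submod_pred ?rpred0 // rpredD // -scaleN1r rpredZ.
Qed.
HB.instance Definition _ :=
  GRing.isZmodClosed.Build M submod_pred submod_pred_closed.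

Definition quot_module : Type := Quotient.quot submod_pred.

HB.instance Definition _ := GRing.Zmodule.on quot_module.

Definition quot_pi (m : M) : quot_module := \pi_(Quotient.quot submod_pred)%qT m.

Definition quot_scale (a : R) (x : quot_module) : quot_module :=
  quot_pi (a *: repr x).

Lemma quot_piE m m' : (quot_pi m = quot_pi m') <-> (m - m' \in N).
Proof.
rewrite /quot_pi; split=> [/eqP|mN]; first by rewrite -Quotient.idealrBE.
by apply/eqP; rewrite -Quotient.idealrBE.
Qed.

Lemma quot_pi_repr x : quot_pi (repr x) = x.
Proof. exact: reprK. Qed.

Lemma quot_piD m m' : quot_pi (m + m') = quot_pi m + quot_pi m'.
Proof. exact: raddfD. Qed.

Lemma quot_piZ a m : quot_scale a (quot_pi m) = quot_pi (a *: m).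
Proof.
by apply/quot_piE; rewrite -scalerBr rpredZ //; apply/quot_piE/quot_pi_repr.
Qed.

Lemma quot_scaleA a b x : quot_scale a (quot_scale b x) = quot_scale (a * b) x.
Proof. by rewrite [quot_scale b x]/quot_scale quot_piZ scalerA. Qed.
Lemma quot_scale1 : left_id 1 quot_scale.
Proof. by move=> x; rewrite /quot_scale scale1r quot_pi_repr. Qed.
Lemma quot_scaleDr : right_distributive quot_scale +%R.
Proof.
move=> a x y; rewrite -[x]quot_pi_repr -[y]quot_pi_repr -quot_piD !quot_piZ.
by rewrite scalerDr quot_piD.
Qed.
Lemma quot_scaleDl x : {morph quot_scale^~ x : a b / a + b}.
Proof. by move=> a b; rewrite /quot_scale scalerDl quot_piD. Qed.

HB.instance Definition _ := GRing.Zmodule_isLmodule.Build R quot_module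
  quot_scaleA quot_scale1 quot_scaleDr quot_scaleDl.

End QuotientModule.

Section QuotientAlgebra.
Variables (K : comNzRingType) (A : comAlgType K) (I : idealr A).

(* The quotient ring A/I of ring_quotient, with its A-induced K-algebra
   structure. *)
Definition quot_alg : Type := {ideal_quot I}.
HB.instance Definition _ := GRing.ComNzRing.on quot_alg.

Definition qa_pi (a : A) : quot_alg := \pi_({ideal_quot I})%qT a.
Lemma qa_pi_zmod : zmod_morphism qa_pi.
Proof. exact: raddfB. Qed.
Lemma qa_pi_monoid : monoid_morphism qa_pi.
Proof. by split=> [|a b]; [exact: rmorph1 | exact: rmorphM]. Qed.
HB.instance Definition _ :=
  GRing.isZmodMorphism.Build A quot_alg qa_pi qa_pi_zmod.
HB.instance Definition _ :=
  GRing.isMonoidMorphism.Build A quot_alg qa_pi qa_pi_monoid.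

Definition qa_scale (k : K) (x : quot_alg) : quot_alg := qa_pi k%:A * x.
Lemma qa_scaleA k l x : qa_scale k (qa_scale l x) = qa_scale (k * l) x.
Proof. by rewrite /qa_scale mulrA -rmorphM -scalerAl mul1r scalerA. Qed.
Lemma qa_scale1 : left_id 1 qa_scale.
Proof. by move=> x; rewrite /qa_scale scale1r rmorph1 mul1r. Qed.
Lemma qa_scaleDr : right_distributive qa_scale +%R.
Proof. by move=> a m n; rewrite /qa_scale mulrDr. Qed.
Lemma qa_scaleDl m : {morph qa_scale^~ m : a b / a + b}.
Proof. by move=> a b; rewrite /qa_scale scalerDl rmorphD mulrDl. Qed.
HB.instance Definition _ := GRing.Zmodule_isLmodule.Build K quot_alg
  qa_scaleA qa_scale1 qa_scaleDr qa_scaleDl.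
Lemma qa_scaleAl (k : K) (x y : quot_alg) : k *: (x * y) = (k *: x) * y.
Proof. exact: mulrA. Qed.
HB.instance Definition _ :=
  GRing.Lmodule_isLalgebra.Build K quot_alg qa_scaleAl.
End QuotientAlgebra.

(* An idealr is proper by definition. *)
Definition maximal_ideal (R : nzRingType) (p : idealr R) : Prop :=
  forall q : idealr R, {subset p <= q} -> {subset q <= p}.

Section I1Modules.
Variable K : fieldType.

(* K[x] as I_1-module. An alias is needed as {poly K} is already an
   lmodType over K. *)
Definition Kx : Type := {poly K}.
HB.instance Definition _ := GRing.Zmodule.on Kx.
Definition Kx_scale (f : I1 K) (p : Kx) : Kx := I1val f p.
Lemma Kx_scaleA f g p : Kx_scale f (Kx_scale g p) = Kx_scale (f * g) p.
Proof. by []. Qed.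
Lemma Kx_scale1 : left_id 1 Kx_scale. Proof. by []. Qed.
Lemma Kx_scaleDr : right_distributive Kx_scale +%R.
Proof. by move=> f p q; apply: linearD. Qed.
Lemma Kx_scaleDl p : {morph Kx_scale^~ p : f g / f + g}.
Proof. by []. Qed.
HB.instance Definition _ := GRing.Zmodule_isLmodule.Build (I1 K) Kx
  Kx_scaleA Kx_scale1 Kx_scaleDr Kx_scaleDl.

(* The left ideal B_1 p generated by a subset p of K[H]. *)
Definition B1_ideal (p : {pred {poly K}}) : {pred (B1 K)^o} := fun b =>
  `[< exists s : seq (B1 K * {poly K}), all (fun u => u.2 \in p) s /\
        b = \sum_(u <- s) u.1 * B1_poly u.2 >].

Lemma B1_ideal_closed p : GRing.submod_closed (B1_ideal p).
Proof.
split=> [|a u v /asboolP[s [sp ->]] /asboolP[t [tp ->]]]; apply/asboolP.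
  by exists [::]; rewrite big_nil.
exists ([seq (a * w.1, w.2) | w <- s] ++ t); split.
  by rewrite all_cat tp andbT all_map.
rewrite big_cat big_map; congr (_ + _); rewrite [LHS]mulr_sumr.
by apply: eq_bigr => w _; rewrite mulrA.
Qed.
HB.instance Definition _ p := GRing.isSubmodClosed.Build (B1 K) (B1 K)^o
  (B1_ideal p) (GRing.submod_closed_semi (B1_ideal_closed p)).

Definition B1_quot (p : {pred {poly K}}) : lmodType (B1 K) :=
  quot_module (B1_ideal p).

End I1Modules.

(* Main.v *)
From HB Require Import structures.
Require Import Defs.
From mathcomp Require Import all_boot all_order all_algebra.
From mathcomp Require Import finmap boolp.
From mathcomp.multinomials Require Import monalg.
From mathcomp Require Import ring zify.

Set Implicit Arguments.
Unset Strict Implicit.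
Unset Printing Implicit Defensive.

Import Order.TTheory GRing.Theory Num.Theory.

Local Open Scope ring_scope.

(** The three assertions rest on one description of the simple modules M over
    I_1. Write d for the derivation, int for the integration, H = d x, and
    e_00 = 1 - int d, an idempotent with d e_00 = 0.

    If d has a nonzero kernel on M, that kernel is a line: the corner
    e_00 I_1 e_00 is K e_00 ([e00_corner]), so ker d = e_00 I_1 v = K v for any
    nonzero v in it. An endomorphism preserves this line and is determined by
    its value on v, so End(M) has dimension one. K[x], with v = 1, is the case
    of assertion (2).

    If d is injective on M, then d int = 1 makes int an inverse of d, every
    e_ij acts by zero, and M is a simple module over B_1 = I_1/F.
    - M with K[H]-torsion: let q in K[H] be a nonzero polynomial of least size
      killing a nonzero vector, and let q v = 0. The vector d^i v is killed by
      tau^i q, and tau^i q acts injectively on ker q for i <> 0, because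
      tau^i q - q is nonzero of smaller size. Hence ker q = K[H] v
      ([ker_minimal_ann]), and an endomorphism is given by f(v) in
      K[H] v, a space of dimension less than the size of q. The same
      description of ker q, for v the class of 1 in B_1/B_1 p and q a generator
      of p, gives assertion (3): f(1) = a(H) 1 with a unique modulo p, and
      each a occurs, through right multiplication.
    - M without K[H]-torsion: B_1 is not simple as a left module, so some
      nonzero b kills a nonzero v, and b v = 0 is a recurrence that expresses
      every d^l v by v, ..., d^(n-1) v after multiplication by a nonzero
      polynomial ([finite_rank]). So any n^2 + 1 endomorphisms f_i satisfy a
      nontrivial relation with coefficients p_i in K[H]. Conjugating it by
      d replaces p_i by tau p_i; the difference tau p_i - p_i lowers every
      nonzero degree, so iteration yields a relation with coefficients in
      K ([poly_to_const_dependent]). *)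

(** * Linear dependence over domains and over fields *)

Section LinearDependence.

(** Brings a kernel vector over the fraction field back to the domain. *)
Lemma fraction_clear_denom (R : idomainType) (x : {fraction R}) :
  exists d : R * R, d.2 != 0 /\ x * (FracField.tofrac d.2) = FracField.tofrac d.1.
Proof.
elim/quotW: x => r; exists (\n_r, \d_r); split; first exact: denom_ratioP.
rewrite -[_ * _]/(FracField.mul _ _) !piE /=; apply/eqP.
rewrite piE FracField.equivfE !numden_Ratio ?mulf_neq0 ?denom_ratioP ?oner_eq0 //=.
by rewrite !mulr1 mulrC.
Qed.

Lemma exists_left_kernel (R : idomainType) (T : finType) (k : nat)
    (A : 'I_k -> T -> R) : (#|T| < k)%N ->
  exists u : 'I_k -> R, (exists i, u i != 0) /\
    forall t, \sum_i u i * A i t = 0.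
Proof.
move=> ltTk.
pose B : 'M[{fraction R}]_(k, #|T|) :=
  \matrix_(i, t) FracField.tofrac (A i (enum_val t)).
have /rowV0Pn[w /sub_kermxP wB /rV0Pn[i0 wi0]] : kermx B != 0.
  rewrite -mxrank_eq0 mxrank_ker -lt0n subn_gt0.
  exact: leq_ltn_trans (rank_leq_col _) ltTk.
have /choice[d dP] i := fraction_clear_denom (w 0 i).
pose u i := (d i).1 * \prod_(j | j != i) (d j).2.
have uE i : FracField.tofrac (u i) = FracField.tofrac (\prod_j (d j).2) * w 0 i.
  by rewrite tofracM -(dP i).2 [in RHS](bigD1 i) //= tofracM; ring.
exists u; split=> [|t].
  exists i0; rewrite -tofrac_eq0 uE mulf_neq0 // tofrac_eq0; apply/prodf_neq0 => i _.
  by case: (dP i).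
apply/eqP; rewrite -tofrac_eq0 rmorph_sum /=.
under eq_bigr do rewrite tofracM uE -mulrA.
rewrite -mulr_sumr (_ : \sum_i _ = (w *m B) 0 (enum_rank t)).
  by rewrite wB mxE mulr0.
by rewrite mxE; apply: eq_bigr => i _; rewrite mxE enum_rankK.
Qed.

(** A maximal free family is a basis, and its coordinate map is the required
    isomorphism; the bound N makes such a family exist. *)
Lemma vector_axiom_of_dependent (K : fieldType) (V : lmodType K) (N : nat) :
  (forall v : 'I_N -> V, exists c : 'I_N -> K,
     (exists i, c i != 0) /\ \sum_i c i *: v i = 0) ->
  exists n, inhabited (Vector.axiom n V).
Proof.
elim: N => [/(_ (fun=> 0))[c [[[] //]]] | N IHN dep].
have [/IHN //|/existsNP[v]] := pselect (forall v : 'I_N -> V,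
  exists c : 'I_N -> K, (exists i, c i != 0) /\ \sum_i c i *: v i = 0).
move=> free_v; exists N.
have unique_coef (r s : 'rV[K]_N) :
    \sum_i r 0 i *: v i = \sum_i s 0 i *: v i -> r = s.
  move=> /eqP; rewrite -subr_eq0 -sumrB => /eqP rs.
  apply/rowP => i; apply/eqP; rewrite -subr_eq0; apply/negPn/negP => neq.
  apply: free_v; exists (fun j => r 0 j - s 0 j); split; first by exists i.
  by rewrite -[RHS]rs; apply: eq_bigr => j _; rewrite scalerBl.
have coef_exists x : exists r : 'rV[K]_N, \sum_i r 0 i *: v i = x.
  have [c [[j cj] sum_c]] := dep (fun i => oapp v x (unlift ord0 i)).
  move: sum_c; rewrite big_ord_recl unlift_none /=.
  under eq_bigr do rewrite liftK /=.
  move=> sum_c.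
  have c0 : c ord0 != 0.
    apply/eqP => c00; move: sum_c; rewrite c00 scale0r add0r => sum_c.
    apply: free_v; exists (fun i => c (lift ord0 i)); split=> //.
    case: (unliftP ord0 j) cj => [i ->|->]; last by rewrite c00 eqxx.
    by exists i.
  exists (\row_i (- (c ord0)^-1 * c (lift ord0 i))).
  move/eqP: sum_c; rewrite addr_eq0 => /eqP sum_c.
  apply: (scalerI c0); rewrite sum_c scaler_sumr -sumrN.
  apply: eq_bigr => i _; rewrite mxE scalerA mulNr mulrN mulrA mulfV // mul1r.
  by rewrite scaleNr.
have [coef coefP] := choice coef_exists.
constructor; exists coef.
  move=> a x y; apply: unique_coef; rewrite coefP -[in LHS](coefP x) -[in LHS](coefP y).
  rewrite scaler_sumr -big_split; apply: eq_bigr => i _ /=.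
  by rewrite !mxE scalerDl scalerA.
exists (fun r : 'rV[K]_N => \sum_i r 0 i *: v i) => [x|r]; first exact: coefP.
by apply: unique_coef; rewrite coefP.
Qed.
End LinearDependence.

(** * The shift automorphism and the elements of B_1 *)

Section Tau.
Variables (K : fieldType) (charK : [pchar K] =i pred0).
Implicit Types (a : {poly K}) (i : int).

Lemma size_tau i a : size (tau i a) = size a.
Proof. by rewrite size_comp_poly2 // size_XaddC. Qed.

Lemma tau_eq0 i a : (tau i a == 0) = (a == 0).
Proof. by rewrite -!size_poly_eq0 size_tau. Qed.

(** The shift preserves leading coefficients, so tau^i - 1 lowers degrees.
    This is the measure that decreases in both finiteness arguments. *)
Lemma size_tau_sub i a : a != 0 -> (size (tau i a - a)%R < size a)%N.
Proof.
rewrite -size_poly_gt0; case sza: (size a) => [//|n] _; rewrite ltnS.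
apply/leq_sizeP => j; rewrite leq_eqVlt coefB => /predU1P[<-|ltnj]; last first.
  by rewrite !nth_default ?subrr ?size_tau ?sza.
have lc : lead_coef (tau i a) = lead_coef a.
  by rewrite lead_coef_comp ?size_XaddC // lead_coefXaddC expr1n mulr1.
by move: lc; rewrite !lead_coefE size_tau sza /= => ->; rewrite subrr.
Qed.

Lemma intr_neq0 i : i != 0 -> i%:~R != 0 :> K.
Proof.
by case: i => [[|n]|n] // _; rewrite ?NegzE ?mulrNz ?oppr_eq0; apply: natrS_neq0.
Qed.

(** Characteristic zero enters here: the values of a polynomial of period i
    agree at the infinitely many points k i. *)
Lemma tau_fixed i a : i != 0 -> tau i a = a -> (size a <= 1)%N.
Proof.
move=> i0 ai.
have periodic n : a.[n%:R * i%:~R] = a.[0].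
  elim: n => [|n IHn]; first by rewrite mul0r.
  by rewrite -natr1 mulrDl mul1r -tau_horner ai.
suff /eqP : a - (a.[0])%:P = 0 by rewrite subr_eq0 => /eqP->; apply: size_polyC_leq1.
apply: (@roots_geq_poly_eq0 _ _
  [seq k%:R * i%:~R | k <- iota 0 (size (a - (a.[0])%:P)%R)]).
- by apply/allP => _ /mapP[k _ ->]; rewrite /root !hornerE periodic subrr.
- rewrite map_inj_uniq ?iota_uniq // => k l /(mulIf (intr_neq0 i0)).
  exact: natr_inj.
- by rewrite size_map size_iota.
Qed.

Lemma tau_sub_neq0 i a : i != 0 -> (1 < size a)%N -> tau i a - a != 0.
Proof.
move=> i0; apply: contraTneq => /eqP; rewrite subr_eq0 -leqNgt => /eqP.
exact: tau_fixed.
Qed.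

End Tau.

Section B1Elements.
Variable K : fieldType.
Implicit Types (a p q : {poly K}) (i j : int) (b c : B1 K).

Definition dpow i : B1 K := << 1 *g i >>.

Lemma dpow0 : dpow 0 = 1. Proof. by []. Qed.

Lemma dpowM i j : dpow i * dpow j = dpow (i + j).
Proof. by rewrite B1_mulU rmorph1 mulr1. Qed.

Lemma dpow_poly i a : dpow i * B1_poly a = B1_poly (tau i a) * dpow i.
Proof. by rewrite !B1_mulU tau0 mul1r mulr1 addrC. Qed.

Lemma B1_monomE a i : << a *g i >> = B1_poly a * dpow i :> B1 K.
Proof. by rewrite B1_mulU tau0 mulr1 add0r. Qed.

Lemma scaler_B1E (c : K) : c%:A = B1_poly c%:P :> B1 K.
Proof. exact: mulr1. Qed.

Lemma B1_expand b : b = \sum_(i <- msupp b) B1_poly b@_i * dpow i.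
Proof. by rewrite {1}[b]monalgE; apply: eq_bigr => i _; rewrite B1_monomE. Qed.

Lemma mcoeff_poly_mul a b i : (B1_poly a * b)@_i = a * b@_i.
Proof.
elim/B1_ind: b => [|b c IHb IHc|p j]; first by rewrite mulr0 mcoeff0 mulr0.
  by rewrite mulrDr !mcoeffD IHb IHc mulrDr.
by rewrite B1_mulU tau0 add0r !mcoeffU mulrnAr.
Qed.

Lemma mcoeff_mul_poly a b i : (b * B1_poly a)@_i = b@_i * tau i a.
Proof.
elim/B1_ind: b => [|b c IHb IHc|p j]; first by rewrite mul0r mcoeff0 mul0r.
  by rewrite mulrDl !mcoeffD IHb IHc mulrDl.
by rewrite B1_mulU addr0 !mcoeffU; case: eqVneq => [->|_]; rewrite ?mul0r.
Qed.

Lemma mcoeff_dpow_mul s b i : (dpow s * b)@_i = tau s b@_(i - s).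
Proof.
elim/B1_ind: b => [|b c IHb IHc|p j]; first by rewrite mulr0 !mcoeff0 rmorph0.
  by rewrite mulrDr !mcoeffD IHb IHc rmorphD.
rewrite B1_mulU mul1r !mcoeffU addrC (can2_eq (addrK s) (subrK s)).
by case: eqP => _; rewrite ?rmorph0.
Qed.

(** Multiplication by a large power of d clears the negative exponents. *)
Lemma dpow_mul_polynomial b : exists (s : int) (n : nat),
  dpow s * b = \sum_(l < n) B1_poly (dpow s * b)@_l%:Z * dpow l%:Z.
Proof.
pose s := (\sum_(i <- msupp b) `|i|)%N; exists s%:Z, (s + s).+1.
have bound i : i \in msupp b -> (`|i| <= s)%N.
  by move=> ib; rewrite /s (big_rem i) //= leq_addr.
apply/malgP => k; rewrite [in RHS]raddf_sum /=.
under [RHS]eq_bigr do rewrite mcoeff_poly_mul mcoeffU.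
have [[[l lts] ->]|k_out] := pselect (exists l : 'I_(s + s).+1, k = l%:Z).
  rewrite (bigD1 (Ordinal lts)) //= eqxx mulr1 big1 ?addr0 // => j jl.
  by rewrite eqz_nat (negbTE (jl : (j : nat) != l)) mulr0.
rewrite big1 => [|j _]; last first.
  by case: eqP => [E|_]; rewrite ?mulr0 //; case: k_out; exists j.
rewrite mcoeff_dpow_mul; apply/eqP; rewrite tau_eq0.
apply: contra_notT k_out; rewrite mcoeff_neq0 => /bound le_s.
have ltk : (`|k| < (s + s).+1)%N by lia.
by exists (Ordinal ltk) => /=; lia.
Qed.

(** The left ideal generated by d - 1 is proper: the sum of the left
    coefficients is invariant under right multiplication by d, so it vanishes on
    that ideal. *)
Lemma dpow_sub1_no_linv b : b * (dpow 1 - 1) != 1.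
Proof.
pose aug (c : B1 K) := \sum_(i <- msupp c) c@_i.
have augE (d : {fset int}) c : (msupp c `<=` d)%fset -> aug c = \sum_(i <- d) c@_i.
  by move=> le; apply: big_fset_incl => // i _ /mcoeff_outdom.
have augD c c' : aug (c + c') = aug c + aug c'.
  rewrite (augE _ _ (msuppD_le c c')) (augE _ _ (fsubsetUl _ (msupp c'))).
  rewrite (augE _ _ (fsubsetUr (msupp c) _)) -big_split.
  by apply: eq_bigr => i _; rewrite mcoeffD.
have augU a i : aug << a *g i >> = a.
  by rewrite (augE _ _ msuppU_le) big_seq_fset1 mcoeffUU.
have augd c : aug (c * dpow 1) = aug c.
  elim/B1_ind: c => [|c c' IH IH'|a i]; first by rewrite mul0r.
    by rewrite mulrDl !augD IH IH'.
  by rewrite B1_mulU rmorph1 mulr1 !augU.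
apply/eqP => /(congr1 aug); rewrite [aug 1]augU => /eqP.
suff -> : aug (b * (dpow 1 - 1)) = 0 by rewrite eq_sym oner_eq0.
apply: (addIr (aug b)); rewrite add0r -augD mulrBr mulr1 subrK; exact: augd.
Qed.

End B1Elements.

(** * Annihilators in B_1-modules *)

Section SimpleModules.
Variables (R : pzRingType) (M : lmodType R) (simpleM : simple_module M).

Lemma simple_cyclic (v x : M) : v != 0 -> exists a : R, x = a *: v.
Proof.
move=> v0; pose N : {pred M} := fun y => `[< exists a : R, y = a *: v >].
have [|N0|NM] := simpleM.2 N.
- split=> [|a y z /asboolP[b ->] /asboolP[c ->]]; apply/asboolP.
    by exists 0; rewrite scale0r.
  by exists (a * b + c); rewrite scalerDl scalerA.
- have/N0 vE : v \in N by apply/asboolP; exists 1; rewrite scale1r.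
  by rewrite vE eqxx in v0.
by have /asboolP := NM x.
Qed.

Lemma simple_endo_eq0 (f : {linear M -> M}) (v : M) :
  v != 0 -> f v = 0 -> forall x, f x = 0.
Proof.
move=> v0 fv x; have [a ->] := simple_cyclic x v0.
by rewrite linearZ /= fv scaler0.
Qed.

End SimpleModules.

Section B1Modules.
Variables (K : fieldType) (charK : [pchar K] =i pred0).
Variable (N : lmodType (B1 K)).
Implicit Types (a p q : {poly K}) (i j : int) (b c : B1 K) (v x y z : N).

Lemma polyZA p q x : B1_poly p *: (B1_poly q *: x) = B1_poly (p * q) *: x.
Proof. by rewrite scalerA -rmorphM. Qed.

Lemma polyZC p q x :
  B1_poly p *: (B1_poly q *: x) = B1_poly q *: (B1_poly p *: x).
Proof. by rewrite !polyZA mulrC. Qed.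

Lemma dpow_polyZ i p x :
  dpow K i *: (B1_poly p *: x) = B1_poly (tau i p) *: (dpow K i *: x).
Proof. by rewrite !scalerA dpow_poly. Qed.

Lemma dpowZA i j x : dpow K i *: (dpow K j *: x) = dpow K (i + j) *: x.
Proof. by rewrite scalerA dpowM. Qed.

Lemma constZ_inj (e : K) x : e != 0 -> B1_poly e%:P *: x = 0 -> x = 0.
Proof.
move=> e0 /(congr1 (fun y => B1_poly (e^-1)%:P *: y)).
by rewrite polyZA -polyCM mulVf // scale1r scaler0.
Qed.

(** A vector killed by both q and tau^i q is killed by their difference, which
    is nonzero of smaller size. *)
Lemma tau_minimal_ann i q z : i != 0 -> q != 0 -> z != 0 ->
  B1_poly q *: z = 0 ->
  (forall a, a != 0 -> B1_poly a *: z = 0 -> (size q <= size a)%N) ->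
  B1_poly (tau i q) *: z != 0.
Proof.
move=> i0 q0 z0 qz minq; apply/eqP => tqz.
have q1 : (1 < size q)%N.
  rewrite ltnNge; apply/negP => /size1_polyC qE; rewrite qE polyC_eq0 in q0.
  by rewrite qE in qz; move/(constZ_inj q0)/eqP: qz; apply/negP.
have := minq _ (tau_sub_neq0 charK i0 q1).
rewrite rmorphB scalerBl tqz qz subrr => /(_ erefl).
by rewrite leqNgt size_tau_sub.
Qed.

(** Subtracting the degree zero term of b leaves z, a combination of the d^i v
    with i <> 0. The product of the corresponding tau^i q kills z, whereas
    each factor acts injectively on ker q; so z = 0. *)
Lemma ker_minimal_ann q v b : q != 0 -> B1_poly q *: v = 0 ->
  (forall z a, z != 0 -> B1_poly q *: z = 0 -> a != 0 -> B1_poly a *: z = 0 ->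
     (size q <= size a)%N) ->
  B1_poly q *: (b *: v) = 0 -> b *: v = B1_poly b@_0 *: v.
Proof.
move=> q0 qv minq qbv; apply/eqP; rewrite -subr_eq0; apply/negPn/negP.
set z := b *: v - _ => z0.
have qz : B1_poly q *: z = 0.
  by rewrite scalerBr qbv sub0r polyZC qv scaler0 oppr0.
pose c := b - B1_poly b@_0.
have c0 i : i \in msupp c -> i != 0.
  rewrite -mcoeff_neq0; apply: contraNneq => ->.
  by rewrite mcoeffB mcoeffUU subrr.
have step (r : seq int) : all (fun i => i != 0) r ->
    let y := B1_poly (\prod_(i <- r) tau i q) *: z in
    y != 0 /\ B1_poly q *: y = 0.
  elim: r => [|i r IHr] /=; first by rewrite big_nil rmorph1 scale1r.
  case/andP=> i0 /IHr[y0 qy]; rewrite big_cons -polyZA.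
  split; last by rewrite polyZC qy scaler0.
  by apply: tau_minimal_ann => // a; apply: minq.
have [|/eqP[]] := step (msupp c); first exact/allP.
rewrite (_ : z = c *: v); last by rewrite scalerBl.
rewrite [c in c *: v]B1_expand scaler_suml scaler_sumr big_seq big1 // => i ci.
rewrite -scalerA polyZC (big_rem i) //= mulrC -polyZA -dpow_polyZ qv.
by rewrite !scaler0.
Qed.

End B1Modules.

(** * Endomorphisms of simple B_1-modules *)

Section Dependence.
Variables (K : fieldType) (charK : [pchar K] =i pred0).
Variable (N : lmodType (B1 K)) (simpleN : simple_module N).
Implicit Types (a p q : {poly K}) (b : B1 K) (v x y z : N).

Definition endo_dependent (k : nat) : Prop :=
  forall f : 'I_k -> {linear N -> N}, exists c : 'I_k -> K,
    (exists i, c i != 0) /\ forall x, \sum_i B1_poly (c i)%:P *: f i x = 0.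

Lemma const_scaleC (e : K) b x :
  B1_poly e%:P *: (b *: x) = b *: (B1_poly e%:P *: x).
Proof. by rewrite !scalerA -scaler_B1E -scalerAl mul1r -scalerAr mulr1. Qed.

(** Each endomorphism sends v into K[H] v, where polynomials may be reduced
    modulo q, so more endomorphisms than the size of q are dependent. *)
Lemma endo_dependent_torsion q x :
  q != 0 -> x != 0 -> B1_poly q *: x = 0 -> exists k, endo_dependent k.
Proof.
move=> q0 x0 qx.
pose P n := `[< exists u : {poly K} * N,
  [/\ u.1 != 0, u.2 != 0, B1_poly u.1 *: u.2 = 0 & size u.1 = n] >].
have exP : exists n, P n by exists (size q); apply/asboolP; exists (q, x).
case: (ex_minnP exP) => n {q0 x0 qx exP} /asboolP[[{}q v] /= [q0 v0 qv szq]] min_n.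
have minq z a : z != 0 -> B1_poly q *: z = 0 -> a != 0 -> B1_poly a *: z = 0 ->
    (size q <= size a)%N.
  by move=> z0 _ a0 az; rewrite szq; apply: min_n; apply/asboolP; exists (a, z).
exists n.+1 => f.
have /choice[a fv] i : exists a, (size a <= n)%N /\ f i v = B1_poly a *: v.
  have [b bE] := simple_cyclic simpleN (f i v) v0.
  have fvE : f i v = B1_poly b@_0 *: v.
    rewrite bE; apply: (@ker_minimal_ann _ charK _ q) => //.
    by rewrite -bE -linearZ /= qv linear0.
  exists (b@_0 %% q); split; first by rewrite -szq ltnW ?ltn_modp.
  rewrite fvE [in LHS](divp_eq b@_0 q) rmorphD scalerDl -polyZA qv.
  by rewrite scaler0 add0r.
have [|c [c0 cA]] := @exists_left_kernel K 'I_n n.+1 (fun i t => (a i)`_t).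
  by rewrite card_ord.
exists c; split=> // y; have [b ->] := simple_cyclic simpleN y v0.
under eq_bigr do rewrite linearZ /= const_scaleC (fv _).2 polyZA mul_polyC.
rewrite -scaler_sumr -scaler_suml -rmorph_sum /= (_ : \sum_i _ = 0).
  by rewrite rmorph0 scale0r scaler0.
apply/polyP => t; rewrite coef_sum coef0.
under eq_bigr do rewrite coefZ.
have [ltn|len] := ltnP t n; first exact: (cA (Ordinal ltn)).
rewrite big1 // => i _; rewrite nth_default ?mulr0 //.
exact: leq_trans (fv i).1 len.
Qed.

Section TorsionFree.
Hypothesis tfN : forall q x, q != 0 -> B1_poly q *: x = 0 -> x = 0.

(** When (d - 1) v <> 0 it generates N, so v = b (d - 1) v for some b, and
    b (d - 1) - 1 is nonzero as d - 1 has no left inverse. *)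
Lemma exists_annihilator v : exists2 b, b != 0 & b *: v = 0.
Proof.
have [dv|dv] := eqVneq ((dpow K 1 - 1) *: v) 0.
  exists (dpow K 1 - 1) => //; apply: contraTneq isT => /(congr1 (mcoeff 1)).
  rewrite mcoeffB mcoeffUU mcoeffU subr0 mcoeff0 => /eqP.
  by rewrite oner_eq0.
have [b vE] := simple_cyclic simpleN v dv.
exists (b * (dpow K 1 - 1) - 1); first by rewrite subr_eq0 dpow_sub1_no_linv.
by rewrite scalerBl scale1r -scalerA -vE subrr.
Qed.

(** Membership in the K(H)-span of v, d v, ..., d^(n-1) v, without localizing. *)
Definition almost_spanned n v x := exists q, q != 0 /\
  exists p : 'I_n -> {poly K},
    B1_poly q *: x = \sum_l B1_poly (p l) *: (dpow K l%:Z *: v).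

Section AlmostSpanned.
Variables (n : nat) (v : N).
Local Notation S := (almost_spanned n v).

Lemma almost_spanned0 : S 0.
Proof.
exists 1; split; first exact: oner_neq0.
exists (fun=> 0); rewrite scaler0 big1 // => i _.
by rewrite rmorph0 scale0r.
Qed.

Lemma almost_spannedD x y : S x -> S y -> S (x + y).
Proof.
move=> [q [q0 [p px]]] [r [r0 [s sy]]]; exists (q * r); rewrite mulf_neq0 //.
split=> //; exists (fun l => r * p l + q * s l).
rewrite scalerDr -[in X in _ + X]polyZA sy mulrC -polyZA px !scaler_sumr.
by rewrite -big_split; apply: eq_bigr => l _; rewrite rmorphD scalerDl !polyZA.
Qed.

Lemma almost_spanned_poly a x : S x -> S (B1_poly a *: x).
Proof.
move=> [q [q0 [p px]]]; exists q; split=> //; exists (fun l => a * p l).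
by rewrite polyZC px scaler_sumr; apply: eq_bigr => l _; rewrite polyZA.
Qed.

Lemma almost_spanned_sum (I : Type) (r : seq I) (F : I -> N) :
  (forall i, S (F i)) -> S (\sum_(i <- r) F i).
Proof.
by move=> SF; apply: big_ind => //; [apply: almost_spanned0|apply: almost_spannedD].
Qed.

Lemma almost_spanned_cancel a x : a != 0 -> S (B1_poly a *: x) -> S x.
Proof.
move=> a0 [q [q0 [p px]]]; exists (q * a); rewrite mulf_neq0 //; split=> //.
by exists p; rewrite -polyZA px.
Qed.

Lemma almost_spanned_gen (l : 'I_n) : S (dpow K l%:Z *: v).
Proof.
exists 1; split; first exact: oner_neq0.
exists (fun i => (i == l)%:R); rewrite scale1r (bigD1 l) //= eqxx scale1r.
by rewrite big1 ?addr0 // => i /negbTE->; rewrite rmorph0 scale0r.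
Qed.

Lemma almost_spanned_common_denominator (T : finType) (y : T -> N) :
  (forall t, S (y t)) -> exists q, q != 0 /\ exists C : T -> 'I_n -> {poly K},
    forall t, B1_poly q *: y t = \sum_l B1_poly (C t l) *: (dpow K l%:Z *: v).
Proof.
move=> Sy; have [q qP] := choice Sy.
have [p pP] := choice (fun t => (qP t).2).
exists (\prod_t q t); split; first by apply/prodf_neq0 => t _; case: (qP t).
exists (fun t l => (\prod_(s | s != t) q s) * p t l) => t.
rewrite (bigD1 t) //= mulrC -polyZA pP scaler_sumr.
by apply: eq_bigr => l _; rewrite polyZA.
Qed.

End AlmostSpanned.

(** Take a nontrivial relation between v, ..., d^n v of minimal length. Its
    extreme coefficients are nonzero, so it expresses d^n v, and after a shift
    d^-1 v, by v, ..., d^(n-1) v up to a nonzero polynomial. The almost spanned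
    vectors thus form a nonzero B_1-submodule. *)
Lemma finite_rank : exists n v, forall x, almost_spanned n v x.
Proof.
have [v v0] := simpleN.1.
pose rel n (p : nat -> {poly K}) := (exists2 l, (l < n)%N & p l != 0) /\
  \sum_(l < n) B1_poly (p l) *: (dpow K l%:Z *: v) = 0.
have exP : exists n, `[< exists p : nat -> {poly K}, rel n p >].
  have [b b0 bv] := exists_annihilator v.
  have [s [n bE]] := dpow_mul_polynomial b.
  exists n; apply/asboolP; exists (fun l => (dpow K s * b)@_l%:Z); split.
    apply: contrapT => none; move/eqP: b0; apply.
    rewrite -[b]mul1r -(dpow0 K) -(addNr s) -dpowM -mulrA bE big1 ?mulr0 // => l _.
    have [->|pl] := eqVneq (dpow K s * b)@_l%:Z 0; first by rewrite rmorph0 mul0r.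
    by case: none; exists l.
  under eq_bigr do rewrite scalerA.
  by rewrite -scaler_suml -bE -scalerA bv scaler0.
case: (ex_minnP exP) => n /asboolP[p [[l0 l0n pl0] pv]] min_n {exP}.
case: n => // n in l0n pv min_n *.
have no_rel r : ~ rel n r.
  by move=> rel_r; have := min_n n (asboolT (ex_intro _ r rel_r)); rewrite ltnn.
have shift (l : nat) : -1 + (bump 0 l)%:Z = l%:Z by rewrite /bump; lia.
exists n, v.
have pn : p n != 0.
  apply/eqP => pn; apply: (no_rel p); split.
    exists l0 => //; rewrite ltn_neqAle -ltnS l0n andbT.
    by apply: contraNneq pl0 => ->; rewrite pn.
  by move: pv; rewrite big_ord_recr /= pn rmorph0 scale0r addr0.
have p0 : p 0 != 0.
  apply/eqP => p0; apply: (no_rel (fun l => tau (-1) (p l.+1))); split.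
    case: l0 => [|l] in l0n pl0; first by rewrite p0 eqxx in pl0.
    by exists l => //; rewrite tau_eq0.
  move: pv; rewrite big_ord_recl /= p0 rmorph0 scale0r add0r.
  move=> /(congr1 (fun y => dpow K (-1) *: y)); rewrite scaler0 => pv.
  rewrite -[RHS]pv scaler_sumr; apply: eq_bigr => l _.
  by rewrite dpow_polyZ dpowZA shift.
have S_n : almost_spanned n v (dpow K n%:Z *: v).
  apply: (almost_spanned_cancel pn).
  move/eqP: pv; rewrite big_ord_recr /= addrC addr_eq0 => /eqP->.
  rewrite -sumrN; apply: almost_spanned_sum => l.
  by rewrite -scaleNr -rmorphN; apply/almost_spanned_poly/almost_spanned_gen.
have S_le l : (l <= n)%N -> almost_spanned n v (dpow K l%:Z *: v).
  rewrite leq_eqVlt => /predU1P[->//|ltl].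
  exact: (almost_spanned_gen _ (Ordinal ltl)).
have S_neg : almost_spanned n v (dpow K (-1) *: v).
  apply: (@almost_spanned_cancel _ _ (tau (-1) (p 0))); first by rewrite tau_eq0.
  rewrite -dpow_polyZ; move/eqP: pv; rewrite big_ord_recl /= addr_eq0 dpow0 scale1r.
  move=> /eqP->; rewrite scalerN scaler_sumr -sumrN.
  apply: almost_spanned_sum => l; rewrite dpow_polyZ dpowZA shift.
  by rewrite -scaleNr -rmorphN; apply/almost_spanned_poly/almost_spanned_gen.
have S_dpow1 x : almost_spanned n v x -> almost_spanned n v (dpow K 1 *: x).
  move=> [q [q0 [r rx]]]; apply: (@almost_spanned_cancel _ _ (tau 1 q)).
    by rewrite tau_eq0.
  rewrite -dpow_polyZ rx scaler_sumr; apply: almost_spanned_sum => l.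
  by rewrite dpow_polyZ dpowZA; apply/almost_spanned_poly/S_le.
have S_dpowN1 x : almost_spanned n v x -> almost_spanned n v (dpow K (-1) *: x).
  move=> [q [q0 [r rx]]]; apply: (@almost_spanned_cancel _ _ (tau (-1) q)).
    by rewrite tau_eq0.
  rewrite -dpow_polyZ rx scaler_sumr; apply: almost_spanned_sum => -[l ltl].
  rewrite dpow_polyZ dpowZA; apply: almost_spanned_poly.
  case: l => [|l] in ltl *; first exact: S_neg.
  by rewrite [in dpow _ _]/= (shift l); apply/S_le/ltnW/ltnW.
have S_dpow i x : almost_spanned n v x -> almost_spanned n v (dpow K i *: x).
  move=> Sx; elim: i => [|l IHl|l IHl]; first by rewrite dpow0 scale1r.
    by rewrite intS -dpowZA; apply: S_dpow1.
  by rewrite intS opprD -dpowZA; apply: S_dpowN1.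
have [|S0|//] := simpleN.2 (fun x => `[< almost_spanned n v x >]).
- split=> [|b x y /asboolP Sx /asboolP Sy]; apply/asboolP.
    exact: almost_spanned0.
  apply: almost_spannedD => //; rewrite [b]B1_expand scaler_suml.
  apply: almost_spanned_sum => i; rewrite -scalerA.
  exact/almost_spanned_poly/S_dpow.
- have /S0 vE : v \in (fun x => `[< almost_spanned n v x >]).
    by apply/asboolP; have := S_le 0 isT; rewrite dpow0 scale1r.
  by rewrite vE eqxx in v0.
move=> SN x; exact/asboolP/SN.
Qed.

(** An endomorphism is determined by the n images of the d^j v, each with n
    coordinates: the n^2 coordinates of n^2 + 1 endomorphisms are dependent. *)
Lemma endo_poly_dependent : exists k, forall f : 'I_k -> {linear N -> N},
  exists p : 'I_k -> {poly K}, (exists i, p i != 0) /\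
    forall x, \sum_i B1_poly (p i) *: f i x = 0.
Proof.
have [n [v spanN]] := finite_rank; exists (n * n).+1 => f.
have [q [q0 [C CE]]] := almost_spanned_common_denominator
  (fun t : 'I_(n * n).+1 * 'I_n => spanN (f t.1 (dpow K t.2%:Z *: v))).
have [|p [p0 pC]] := @exists_left_kernel {poly K} ('I_n * 'I_n)%type _
  (fun i t => C (i, t.1) t.2).
  by rewrite card_prod !card_ord.
exists p; split=> // x.
have pgen (j : 'I_n) : \sum_i B1_poly (p i) *: f i (dpow K j%:Z *: v) = 0.
  apply: (tfN q0); rewrite scaler_sumr.
  under eq_bigr do rewrite polyZC (CE (_, j)) scaler_sumr.
  rewrite exchange_big big1 // => l _ /=.
  under eq_bigr do rewrite polyZA.
  by rewrite -scaler_suml -rmorph_sum (pC (j, l)) rmorph0 scale0r.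
have [r [r0 [s sx]]] := spanN x; apply: (tfN r0).
rewrite scaler_sumr.
under eq_bigr do rewrite polyZC -linearZ /= sx linear_sum scaler_sumr.
rewrite exchange_big big1 // => l _ /=.
under eq_bigr do rewrite linearZ /= polyZC.
by rewrite -scaler_sumr pgen scaler0.
Qed.

(** Conjugating the relation by d turns p_i into tau p_i. Replacing p_i by
    tau p_i - p_i keeps a relation, which is still nontrivial as long as some p_i is
    not constant, and lowers the total size. *)
Lemma poly_to_const_dependent k (f : 'I_k -> {linear N -> N})
    (p : 'I_k -> {poly K}) :
  (exists i, p i != 0) -> (forall x, \sum_i B1_poly (p i) *: f i x = 0) ->
  exists c : 'I_k -> K,
    (exists i, c i != 0) /\ forall x, \sum_i B1_poly (c i)%:P *: f i x = 0.
Proof.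
have [m] := ubnP (\sum_i size (p i)); elim: m p => // m IHm p lem p0 pf.
have [p_const|/existsNP[i0 p_i0]] := pselect (forall i, (size (p i) <= 1)%N).
  exists (fun i => (p i)`_0); split=> [|x].
    case: p0 => i pi0; exists i; apply: contraNneq pi0 => p00.
    by rewrite (size1_polyC (p_const i)) p00 polyC0.
  by rewrite -[RHS](pf x); apply: eq_bigr => i _; rewrite -size1_polyC.
have le_size i : (size (tau 1 (p i) - p i)%R <= size (p i))%N.
  have [->|pi0] := eqVneq (p i) 0; first by rewrite rmorph0 subrr.
  exact/ltnW/size_tau_sub.
apply: (IHm (fun i => tau 1 (p i) - p i)).
- rewrite -ltnS; apply: leq_trans lem; rewrite ltnS (bigD1 i0) //=.
  rewrite [ltnRHS](bigD1 i0) //= -addSn leq_add //; last exact: leq_sum.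
  by apply: size_tau_sub; apply: contra_not_neq p_i0 => ->; rewrite size_poly0.
- by exists i0; apply: (tau_sub_neq0 charK) => //; rewrite ltnNge; apply/negP.
move=> x; under eq_bigr do rewrite rmorphB scalerBl.
rewrite sumrB pf subr0; apply: etrans (scaler0 N (dpow K 1)).
rewrite -[in RHS](pf (dpow K (-1) *: x)) scaler_sumr; apply: eq_bigr => i _.
by rewrite dpow_polyZ [in RHS]linearZ /= dpowZA subrr dpow0 scale1r.
Qed.

End TorsionFree.

Lemma simple_B1_endo_dependent : exists k, endo_dependent k.
Proof.
have [[q [x [q0 x0 qx]]]|tf] := pselect (exists q x,
  [/\ q != 0, x != 0 & B1_poly q *: x = 0]).
  exact: endo_dependent_torsion qx.
have tfN q x : q != 0 -> B1_poly q *: x = 0 -> x = 0.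
  move=> q0 qx; apply/eqP/negPn/negP => x0; apply: tf; by exists q, x.
have [k kP] := endo_poly_dependent tfN; exists k => f.
by have [p [p0 pf]] := kP f; apply: poly_to_const_dependent pf.
Qed.

End Dependence.

(** * Simple I_1-modules *)

Section FactorModule.
Variables (R S : pzRingType) (f : {rmorphism R -> S}) (M : lmodType R).

(** The S-module structure on M; the two hypotheses are arguments so that
    instances can be attached to the alias. *)
Definition factor_module (f_surj : forall b, exists a, f a = b)
  (ker_acts0 : forall a (m : M), f a = 0 -> a *: m = 0) : Type := M.

Variables (f_surj : forall b, exists a, f a = b)
  (ker_acts0 : forall a (m : M), f a = 0 -> a *: m = 0).
Local Notation fM := (factor_module f_surj ker_acts0).

HB.instance Definition _ := GRing.Zmodule.on fM.

Definition factor_scale (b : S) (m : fM) : fM := projT1 (cid (f_surj b)) *: (m : M).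

Lemma factor_scaleE a (m : fM) : factor_scale (f a) m = a *: (m : M).
Proof.
apply/eqP; rewrite -subr_eq0 -[_ - _]scalerBl; apply/eqP/ker_acts0.
by rewrite rmorphB (projT2 (cid (f_surj (f a)))) subrr.
Qed.

Lemma factor_scaleA a b m :
  factor_scale a (factor_scale b m) = factor_scale (a * b) m.
Proof.
have [[a' <-] [b' <-]] := (f_surj a, f_surj b).
by rewrite -rmorphM !factor_scaleE [LHS]scalerA.
Qed.
Lemma factor_scale1 : left_id 1 factor_scale.
Proof. by move=> m; rewrite -(rmorph1 f) factor_scaleE scale1r. Qed.
Lemma factor_scaleDr : right_distributive factor_scale +%R.
Proof. by move=> a m n; rewrite /factor_scale [LHS]scalerDr. Qed.
Lemma factor_scaleDl m : {morph factor_scale^~ m : a b / a + b}.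
Proof.
move=> a b /=; have [[a' <-] [b' <-]] := (f_surj a, f_surj b).
by rewrite -rmorphD !factor_scaleE [LHS]scalerDl.
Qed.

HB.instance Definition _ := GRing.Zmodule_isLmodule.Build S fM
  factor_scaleA factor_scale1 factor_scaleDr factor_scaleDl.

Lemma factor_moduleZ a (m : fM) : f a *: m = a *: (m : M) :> M.
Proof. exact: factor_scaleE. Qed.

Lemma factor_simple : simple_module M -> simple_module fM.
Proof.
move=> [M0 simpleM]; split=> // N [N0 Nlin]; apply: simpleM; split=> // a u v uN vN.
by rewrite -[a *: u](factor_moduleZ a u); apply: Nlin.
Qed.

Section FactorEndo.
Variable g : {linear M -> M}.
Definition factor_fun (m : fM) : fM := g m.
Lemma factor_fun_linear : linear factor_fun.
Proof.
move=> b u v; have [a <-] := f_surj b; rewrite /factor_fun.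
by rewrite [in RHS]factor_moduleZ [f a *: u]factor_moduleZ [LHS]linearP.
Qed.
HB.instance Definition _ :=
  GRing.isLinear.Build S fM fM *:%R factor_fun factor_fun_linear.
Definition factor_endo : {linear fM -> fM} := factor_fun.
End FactorEndo.

End FactorModule.

Lemma endo_sum_scaleE (K : comNzRingType) (A : algType K) (M : lmodType A)
    (I : Type) (r : seq I) (c : I -> K) (f : I -> endo M) (x : M) :
  (\sum_(i <- r) c i *: f i : endo M) x = \sum_(i <- r) (c i)%:A *: f i x.
Proof. exact: (big_morph (fun g : endo M => g x)). Qed.

Section I1Modules.
Variables (K : fieldType) (charK : [pchar K] =i pred0).
Implicit Types (f g : I1 K).

Local Notation d := (I1d K).
Local Notation int_x := (I1i K).
Local Notation e00 := (I1e K 0%N 0%N).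

Lemma mulIdi : d * int_x = 1.
Proof.
apply: val_inj; apply: (endo_divpowP charK) => n.
by rewrite [LHS](I1act_mul d) -[int_x]expr1 I1iX_divpow (I1d_divpow charK) subSz1.
Qed.

Lemma e00E : e00 = 1 - int_x * d.
Proof. by rewrite /I1e mulr1. Qed.

Lemma e00_act (p : {poly K}) : I1val e00 p = (p`_0)%:P.
Proof.
rewrite e00E I1act_sub I1act_mul; apply/polyP => -[|n].
  by rewrite coefB coef_integx subr0 coefC.
rewrite coefB coef_integx coef_deriv coefC /= -[p`_ _ *+ _]mulr_natr mulfK ?subrr //.
exact: natrS_neq0.
Qed.

(** The operator e_00 is evaluation at 0 followed by the inclusion of the
    constants. *)
Lemma e00_corner f : e00 * f * e00 = ((I1val f 1)`_0 : K) *: e00.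
Proof.
apply: val_inj; apply: endoP => p.
rewrite [RHS]I1act_scale [LHS]I1act_mul I1act_mul !e00_act.
have -> : (p`_0)%:P = p`_0 *: 1 by rewrite -mul_polyC mulr1.
by rewrite linearZ [_`_0]coefZ mulrC polyCM -!mul_polyC mulr1.
Qed.

Section Module.
Variable M : lmodType (I1 K).
Implicit Types (m v w : M).

Lemma ker_d_e00 m : d *: m = 0 -> e00 *: m = m.
Proof.
by move=> dm; rewrite e00E scalerBl scale1r -scalerA dm scaler0 subr0.
Qed.

Lemma ker_d_line v w : simple_module M -> v != 0 -> d *: v = 0 -> d *: w = 0 ->
  exists e : K, w = e%:A *: v.
Proof.
move=> simpleM v0 dv dw; have [f wE] := simple_cyclic simpleM w v0.
exists ((I1val f 1)`_0).
have -> : w = (e00 * f * e00) *: v by rewrite -!scalerA (ker_d_e00 dv) -wE ker_d_e00.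
by rewrite e00_corner -[_ *: e00]mulr_algl -scalerA ker_d_e00.
Qed.

(** If d is injective then d (int d - 1) = 0 gives int d = 1 on M, so each e_ij
    acts by zero. *)
Lemma I1_ker_acts0 : (forall m, d *: m = 0 -> m = 0) ->
  forall f m, I1_to_B1 charK f = 0 -> f *: m = 0.
Proof.
move=> inj_d f m /(I1_to_B1_ker charK)[n [c ->]].
have id_acts1 w : int_x *: (d *: w) = w.
  apply/eqP; rewrite -subr_eq0; apply/eqP/inj_d.
  by rewrite scalerBr !scalerA mulrA mulIdi mul1r subrr.
rewrite scaler_suml big1 // => i _; rewrite scaler_suml big1 // => j _.
rewrite -mulr_algl -scalerA scalerBl exprSr exprS -!scalerA id_acts1 subrr.
by rewrite scaler0.
Qed.

End Module.

Lemma simple_endo_finite (M : lmodType (I1 K)) : simple_module M ->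
  exists n : nat, inhabited (Vector.axiom n (endo M)).
Proof.
move=> simpleM.
have [[v [v0 dv]]|no_ker] := pselect (exists v : M, v != 0 /\ d *: v = 0).
  apply: (@vector_axiom_of_dependent _ _ 2) => f.
  have /choice[e fv] i : exists e : K, f i v = e%:A *: v.
    by apply: ker_d_line => //; rewrite -linearZ /= dv linear0.
  have [|c [c0 ce]] := @exists_left_kernel K unit 2 (fun i _ => e i).
    by rewrite card_unit.
  exists c; split=> //; apply: endoP => x.
  apply: (simple_endo_eq0 simpleM v0); rewrite endo_sum_scaleE.
  under eq_bigr do rewrite fv scalerA mulr_algl scalerA.
  by rewrite -!scaler_suml (ce tt) !scale0r.
have inj_d (m : M) : d *: m = 0 -> m = 0.
  by move=> dm; apply/eqP/negPn/negP => m0; apply: no_ker; exists m.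
pose N := factor_module (I1_to_B1_surj charK) (I1_ker_acts0 inj_d).
have simpleN : simple_module N by apply: factor_simple.
have [k dep] := simple_B1_endo_dependent charK simpleN.
apply: (@vector_axiom_of_dependent _ _ k) => f.
have [c [c0 cf]] := dep (fun i => factor_endo (I1_to_B1_surj charK) (I1_ker_acts0 inj_d) (f i)).
exists c; split=> //; apply: endoP => x.
rewrite endo_sum_scaleE -[RHS](cf x); apply: eq_bigr => i _.
have -> : B1_poly (c i)%:P = I1_to_B1 charK (c i)%:A.
  by rewrite linearZ rmorph1; apply: esym (scaler_B1E _).
symmetry; exact: (@factor_moduleZ _ _ (I1_to_B1 charK) M
  (I1_to_B1_surj charK) (I1_ker_acts0 inj_d) _ _).
Qed.

End I1Modules.

(** * Endomorphisms of K[x] *)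

Lemma surjective_injective_bijective (T U : Type) (f : T -> U) :
  injective f -> (forall y, exists x, f x = y) -> bijective f.
Proof.
move=> f_inj /choice[g fg]; exists g => // x.
by apply: f_inj; rewrite fg.
Qed.

Section EndKx.
Variables (K : fieldType) (charK : [pchar K] =i pred0).
Implicit Types (f g : endo (Kx K)).

Let one : Kx K := (1 : {poly K}).

Lemma Kx_cyclic (p : Kx K) : exists a : I1 K, p = a *: one.
Proof.
elim/poly_ind: p => [|p c [a pE]]; first by exists 0; rewrite scale0r.
exists (I1x K * a + c%:A); rewrite scalerDl -scalerA -pE.
rewrite [_ + _ in RHS]/(GRing.add _ _) /=.
congr (_ + _); first by rewrite mulrC.
by rewrite [RHS]I1act_scale -[RHS]/(c *: (1 : {poly K})) -mul_polyC mulr1.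
Qed.

Lemma endo_Kx_one f : exists c : K, f one = c%:A *: one.
Proof.
exists ((f one : {poly K})`_0).
have df : I1d K *: f one = 0.
  rewrite -linearZ (_ : _ *: one = 0) ?linear0 //.
  exact: derivC.
rewrite -[LHS](ker_d_e00 df) [RHS]I1act_scale [LHS]e00_act //.
by rewrite -[RHS]mul_polyC mulr1.
Qed.

Definition endo_Kx_scalar f : K^o := (f one : {poly K})`_0.

Lemma endo_Kx_scalarE f (c : K) : f one = c%:A *: one -> endo_Kx_scalar f = c.
Proof.
rewrite /endo_Kx_scalar => ->; rewrite [_ *: _]I1act_scale.
by rewrite [LHS]coefZ coefC mulr1.
Qed.

Lemma endo_Kx_scalar_zmod : zmod_morphism endo_Kx_scalar.
Proof. by move=> f g; rewrite /endo_Kx_scalar [LHS]coefB. Qed.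

Lemma endo_Kx_scalar_monoid : monoid_morphism endo_Kx_scalar.
Proof.
split=> [|f g]; first by rewrite /endo_Kx_scalar [LHS]coefC.
have [[c fc] [e ge]] := (endo_Kx_one f, endo_Kx_one g).
rewrite (endo_Kx_scalarE fc) (endo_Kx_scalarE ge); apply: endo_Kx_scalarE.
by rewrite [LHS](congr1 f ge) linearZ /= fc scalerA -scalerAl mul1r scalerA mulrC.
Qed.

HB.instance Definition _ :=
  GRing.isZmodMorphism.Build (endo (Kx K)) K^o endo_Kx_scalar endo_Kx_scalar_zmod.
HB.instance Definition _ :=
  GRing.isMonoidMorphism.Build (endo (Kx K)) K^o endo_Kx_scalar endo_Kx_scalar_monoid.

Lemma endo_Kx_iso : exists2 phi : {rmorphism endo (Kx K) -> K^o},
  scalable phi & bijective phi.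
Proof.
exists endo_Kx_scalar.
  move=> c f; have [e fe] := endo_Kx_one f.
  rewrite /= (endo_Kx_scalarE fe); apply: endo_Kx_scalarE.
  by rewrite -[LHS]/(c%:A *: f one) fe scalerA -scalerAl mul1r scalerA.
apply: surjective_injective_bijective => [f g fg|c].
  apply: endoP => p; have [a ->] := Kx_cyclic p; rewrite !linearZ /=.
  have [[c fc] [e ge]] := (endo_Kx_one f, endo_Kx_one g).
  by move: fg; rewrite /= (endo_Kx_scalarE fc) (endo_Kx_scalarE ge) fc ge => ->.
by exists ((c : K) *: (1 : endo (Kx K))); apply: endo_Kx_scalarE.
Qed.

End EndKx.

(** * Endomorphisms of B_1/B_1 p *)

Section MakeIdeal.
Variables (R : nzRingType) (S : {pred R}).
(** An alias carrying the proof, so that a predicate met inside a proof can be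
    used as an ideal. *)
Definition ideal_of (S_ideal : idealr_closed S) : {pred R} := S.
Variable S_ideal : idealr_closed S.
HB.instance Definition _ := isIdealr.Build R (ideal_of S_ideal) S_ideal.
End MakeIdeal.

Section MaximalIdeals.
Variables (K : fieldType) (charK : [pchar K] =i pred0) (p : idealr {poly K}).
Implicit Types (a q r : {poly K}) (b c : B1 K).

Lemma qa_piE a q : qa_pi p a = qa_pi p q <-> a - q \in p.
Proof.
rewrite /qa_pi; split=> [/eqP|apq]; first by rewrite -Quotient.idealrBE.
by apply/eqP; rewrite -Quotient.idealrBE.
Qed.

Lemma mem_B1_ideal_poly q : q \in p -> B1_poly q \in B1_ideal p.
Proof.
move=> qp; apply/asboolP; exists [:: (1, q)]; rewrite /= qp; split=> //.
by rewrite big_seq1 mul1r.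
Qed.

Lemma B1_ideal_coef0 b : b \in B1_ideal p -> b@_0 \in p.
Proof.
move=> /asboolP[s [/allP sp ->]]; rewrite raddf_sum /= big_seq.
apply: rpred_sum => u us; rewrite mcoeff_mul_poly tau0.
exact/idealMr/sp.
Qed.

Lemma B1_ideal_mul_poly b a : b \in B1_ideal p -> b * B1_poly a \in B1_ideal p.
Proof.
move=> /asboolP[s [/allP sp ->]]; rewrite mulr_suml big_seq.
apply: rpred_sum => u us; rewrite -mulrA -rmorphM mulrC rmorphM mulrA.
by apply: rpredZ; apply/mem_B1_ideal_poly/sp.
Qed.

Hypothesis maxp : maximal_ideal p.

(** The ideal p + (a) strictly contains p, so it contains 1. *)
Lemma maximal_inv a : a \notin p -> exists r, 1 - a * r \in p.
Proof.
move=> ap; pose S : {pred {poly K}} := fun x => `[< exists r, x - a * r \in p >].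
have [/asboolP//|S1] := boolP (1 \in S).
have S_ideal : idealr_closed S.
  split=> // [|x y z /asboolP[r yr] /asboolP[s zs]]; apply/asboolP.
    by exists 0; rewrite mulr0 subrr rpred0.
  exists (x * r + s); rewrite (_ : _ - _ = x * (y - a * r) + (z - a * s)); last by ring.
  by rewrite rpredD // idealMr.
have sub_p : {subset ideal_of S_ideal <= p}.
  apply: maxp => x xp; apply/asboolP; exists 0.
  by rewrite mulr0 subr0.
case/negP: ap; apply: sub_p; apply/asboolP; exists 1.
by rewrite mulr1 subrr rpred0.
Qed.

(** The existence of a nonzero element of p uses maximality: either X lies in p,
    or 1 - X r does for some r, with constant term 1. *)
Lemma maximal_min_size : exists q,
  [/\ q != 0, q \in p & forall r, r \in p -> r != 0 -> (size q <= size r)%N].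
Proof.
pose P n := `[< exists q, [/\ q != 0, q \in p & size q = n] >].
have exP : exists n, P n.
  suff [q [q0 qp]] : exists q, q != 0 /\ q \in p.
    by exists (size q); apply/asboolP; exists q.
  have [Xp|/maximal_inv[r rp]] := boolP ('X \in p).
    by exists 'X; rewrite polyX_eq0.
  exists (1 - 'X * r); split=> //; apply: contraTneq isT => /(congr1 (horner^~ 0)).
  by rewrite !hornerE subr0 => /eqP; rewrite oner_eq0.
case: (ex_minnP exP) => n /asboolP[q [q0 qp sq]] min_n.
exists q; split=> // r rp r0; rewrite sq; apply: min_n; apply/asboolP.
by exists r.
Qed.

Local Notation M := (restrict_scalars (I1_to_B1 charK) (B1_quot p)).
Local Notation one := (quot_pi (B1_ideal p) (1 : B1 K)).
Implicit Types (f g : endo M) (x y : B1_quot p).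

Lemma restrict_endoZ f b x : f (b *: x) = b *: (f x : B1_quot p).
Proof.
have [a <-] := I1_to_B1_surj charK b.
exact: (linearZ_LR f a (x : M)).
Qed.

Lemma quot_piZE b c :
  b *: (quot_pi (B1_ideal p) c : B1_quot p) = quot_pi (B1_ideal p) (b * c).
Proof. exact: (quot_piZ (B1_ideal p) b c). Qed.

Lemma quot_pi_one x : exists b, x = b *: (one : B1_quot p).
Proof. by exists (repr x); rewrite quot_piZE mulr1 quot_pi_repr. Qed.

Lemma poly_one_eq0 a : B1_poly a *: (one : B1_quot p) = 0 <-> a \in p.
Proof.
have q0 : 0 = quot_pi (B1_ideal p) 0 by rewrite [RHS]raddf0.
rewrite quot_piZE mulr1 q0; split=> [/quot_piE|ap].
  by rewrite subr0 => /B1_ideal_coef0; rewrite mcoeffUU.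
by apply/quot_piE; rewrite subr0 mem_B1_ideal_poly.
Qed.

(** The annihilator in K[H] of z is a proper ideal containing q, which
    generates p, so it is p by maximality. *)
Lemma maximal_min_ann q (N : lmodType (B1 K)) (z : N) a : q \in p ->
  (forall r, r \in p -> r != 0 -> (size q <= size r)%N) -> q != 0 ->
  z != 0 -> B1_poly q *: z = 0 -> a != 0 -> B1_poly a *: z = 0 ->
  (size q <= size a)%N.
Proof.
move=> qp minq q0 z0 qz a0 az.
have [ap|/maximal_inv[r rp]] := boolP (a \in p); first exact: minq.
case/eqP: z0.
have -> : z = B1_poly (1 - a * r) *: z.
  by rewrite rmorphB scalerBl rmorph1 scale1r mulrC -polyZA az scaler0 subr0.
set s := 1 - a * r in rp *.
have sE : s %% q = s - s %/ q * q.
  by apply/eqP; rewrite eq_sym subr_eq addrC -divp_eq.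
have modp0 : s %% q = 0.
  apply/eqP/negPn/negP => /minq; rewrite {1}sE rpredB ?idealMr // => /(_ isT).
  by rewrite leqNgt ltn_modp q0.
by rewrite (divp_eq s q) modp0 addr0 -polyZA qz scaler0.
Qed.

(** As q kills the class of 1, it kills f(1), and ker q is K[H] times that
    class. *)
Lemma endo_one f : exists a, f one = B1_poly a *: (one : B1_quot p).
Proof.
have [q [q0 qp minq]] := maximal_min_size.
have [b bE] := quot_pi_one (f one); exists b@_0.
have q_one : B1_poly q *: (one : B1_quot p) = 0 by apply/poly_one_eq0.
have minq_ann (z : B1_quot p) a : z != 0 -> B1_poly q *: z = 0 -> a != 0 ->
    B1_poly a *: z = 0 -> (size q <= size a)%N.
  by move=> z0 qz a0 az; apply: (maximal_min_ann qp minq q0 z0 qz a0 az).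
rewrite bE; apply: (ker_minimal_ann charK q0 q_one minq_ann).
by rewrite -bE -restrict_endoZ q_one linear0.
Qed.

(** Elements of B_1 p have their degree zero coefficient in p, so this does not
    depend on the representative. *)
Definition quot_coef0 x : quot_alg p := qa_pi p (repr x)@_0.

Definition endo_quot f : quot_alg p := quot_coef0 (f one).

Lemma endo_quotE f a :
  f one = B1_poly a *: (one : B1_quot p) -> endo_quot f = qa_pi p a.
Proof.
rewrite /endo_quot => ->; rewrite quot_piZE mulr1 /quot_coef0.
apply/qa_piE; have /quot_piE/B1_ideal_coef0 := quot_pi_repr (quot_pi (B1_ideal p) (B1_poly a)).
by rewrite mcoeffB mcoeffUU.
Qed.

Lemma endo_quot_zmod : zmod_morphism endo_quot.
Proof.
move=> f g; have [[a fa] [c gc]] := (endo_one f, endo_one g).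
rewrite (endo_quotE fa) (endo_quotE gc) -rmorphB; apply: endo_quotE.
by rewrite rmorphB scalerBl -fa -gc.
Qed.

Lemma endo_quot_monoid : monoid_morphism endo_quot.
Proof.
split=> [|f g].
  by rewrite -(rmorph1 (qa_pi p)); apply: endo_quotE; rewrite rmorph1 scale1r.
have [[a fa] [c gc]] := (endo_one f, endo_one g).
rewrite (endo_quotE fa) (endo_quotE gc) -rmorphM; apply: endo_quotE.
transitivity (f (B1_poly c *: (one : B1_quot p))); first exact: (congr1 f gc).
rewrite restrict_endoZ fa (mulrC a c); exact: polyZA.
Qed.

HB.instance Definition _ :=
  GRing.isZmodMorphism.Build (endo M) (quot_alg p) endo_quot endo_quot_zmod.
HB.instance Definition _ :=
  GRing.isMonoidMorphism.Build (endo M) (quot_alg p) endo_quot endo_quot_monoid.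

Section RightMul.
Variable a : {poly K}.
(** Right multiplication by a(H) preserves B_1 p because K[H] is commutative. *)
Definition right_mul (x : M) : M :=
  quot_pi (B1_ideal p) (repr (x : B1_quot p) * B1_poly a).

Lemma right_mulE b : right_mul (quot_pi (B1_ideal p) b) =
  quot_pi (B1_ideal p) (b * B1_poly a).
Proof.
by apply/quot_piE; rewrite -mulrBl B1_ideal_mul_poly //; apply/quot_piE/quot_pi_repr.
Qed.

Lemma right_mul_linear : linear right_mul.
Proof.
move=> e x y; pose pi := quot_pi (B1_ideal p).
have [b bE] : exists b, x = pi b by exists (repr (x : B1_quot p)); rewrite /pi quot_pi_repr.
have [c cE] : exists c, y = pi c by exists (repr (y : B1_quot p)); rewrite /pi quot_pi_repr.
have linE (b' c' : B1 K) : e *: (pi b' : M) + pi c' = pi (I1_to_B1 charK e * b' + c').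
  rewrite /pi quot_piD; congr (_ + _); exact: quot_piZE.
rewrite bE cE linE !right_mulE linE mulrDl mulrA.
reflexivity.
Qed.


HB.instance Definition _ :=
  GRing.isLinear.Build (I1 K) M M *:%R right_mul right_mul_linear.
End RightMul.

Lemma endo_quot_iso : exists2 phi : {rmorphism endo M -> quot_alg p},
  scalable phi & bijective phi.
Proof.
exists endo_quot.
  move=> c f; have [a fa] := endo_one f.
  rewrite /= (endo_quotE fa) (@endo_quotE _ (c%:P * a)).
    by rewrite rmorphM; congr (_ * _); rewrite alg_polyC.
  have -> : (c *: f) one = I1_to_B1 charK c%:A *: (f one : B1_quot p) by [].
  have -> : I1_to_B1 charK c%:A = B1_poly c%:P.
    by rewrite linearZ rmorph1; apply: scaler_B1E.
  by rewrite fa; exact: polyZA.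
apply: surjective_injective_bijective => [f g fg|y].
  apply: endoP => x; have [b ->] := quot_pi_one x.
  suff fg1 : f one = g one by rewrite (restrict_endoZ f) (restrict_endoZ g) fg1.
  have [[a fa] [c gc]] := (endo_one f, endo_one g).
  move: fg; rewrite /= (endo_quotE fa) (endo_quotE gc) fa gc => /qa_piE ac.
  by apply/eqP; rewrite -subr_eq0 -scalerBl -rmorphB; apply/eqP/poly_one_eq0.
elim/quotW: y => a; exists (right_mul a : {linear M -> M}).
by apply: endo_quotE; rewrite [LHS]right_mulE mul1r quot_piZE mulr1.
Qed.

End MaximalIdeals.

Theorem theorem3p4 (K : fieldType) (charK : [pchar K] =i pred0) :
  (forall M : lmodType (I1 K), simple_module M ->
     exists n : nat, inhabited (Vector.axiom n (endo M))) /\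
  (exists2 phi : {rmorphism endo (Kx K) -> K^o},
     scalable phi & bijective phi) /\
  (forall p : idealr {poly K}, maximal_ideal p ->
     exists2 phi : {rmorphism
         endo (restrict_scalars (I1_to_B1 charK) (B1_quot p)) -> quot_alg p},
       scalable phi & bijective phi).
Proof.
split; first exact: simple_endo_finite.
split; first exact: endo_Kx_iso.
exact: endo_quot_iso.
Qed.
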